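(* There are uncountably many pairwise non-isomorphic topological groups that are totally disconnected, locally compact, compactly generated, simple (as abstract groups) and not discrete. *)

(* Defs.v *)
From HB Require Import structures.
From mathcomp Require Import all_boot all_order all_algebra.
From mathcomp Require Import all_classical all_reals all_analysis.
Set Implicit Arguments. Unset Strict Implicit. Unset Printing Implicit Defensive.
Local Open Scope classical_set_scope.

Record topGroup := TopGroup {
  tg_car :> topologicalType;
  tg_mul : tg_car -> tg_car -> tg_car;
  tg_inv : tg_car -> tg_car;
  tg_one : tg_car;
  tg_mulA : forall x y z, tg_mul x (tg_mul y z) = tg_mul (tg_mul x y) z;
  tg_mul1g : forall x, tg_mul tg_one x = x;
  tg_mulVg : forall x, tg_mul (tg_inv x) x = tg_one;
  tg_mul_cont : continuous (fun p : tg_car * tg_car => tg_mul p.1 p.2);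
  tg_inv_cont : continuous tg_inv }.

Section Defs.
Variable G : topGroup.

Definition is_subgroup (H : set G) :=
  [/\ H (tg_one G),
      (forall x y, H x -> H y -> H (tg_mul x y)) &
      (forall x, H x -> H (tg_inv x))].

Definition is_normal_subgroup (N : set G) :=
  is_subgroup N /\
  forall g x, N x -> N (tg_mul (tg_mul g x) (tg_inv g)).

Definition abstractly_simple :=
  (exists x : G, x <> tg_one G) /\
  forall N : set G, is_normal_subgroup N -> N = [set tg_one G] \/ N = setT.

Definition generated_subgroup (K : set G) : set G :=
  fun x => forall H : set G, is_subgroup H -> K `<=` H -> H x.

Definition compactly_generated :=
  exists K : set G, compact K /\ generated_subgroup K = setT.

Definition discrete_topgroup := forall A : set G, open A.

Definition tdlc_cgs_nondiscrete :=
  [/\ totally_disconnected (setT : set G),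
      locally_compact (setT : set G),
      compactly_generated,
      abstractly_simple &
      ~ discrete_topgroup].
End Defs.

Definition topgroup_iso (G H : topGroup) :=
  exists (f : G -> H) (g : H -> G),
    [/\ cancel f g, cancel g f,
        (forall x y, f (tg_mul x y) = tg_mul (f x) (f y)),
        continuous f & continuous g].

Definition uncountable_type (I : Type) := ~ exists f : I -> nat, injective f.

(* Main.v *)
(* Let F be a finitely generated permutation group of a countable set of colours,
   transitive, generated by involutions that fix a colour, with finite point
   stabilisers that are not all trivial. As in the constructions of Burger-Mozes
   and Smith, consider the automorphisms of the regular tree (the Cayley graph of
   the free product of copies of Z/2 indexed by the colours) whose local action at
   each vertex lies in F and which preserve the parity of vertices. For the
   topology of pointwise convergence the edge stabilisers are compact and open,
   and Tits' argument shows that the group is simple.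

   The pointwise stabiliser K of the star of a vertex is compact and open, and F
   is generated by the images of finitely many elements that normalise K.
   A second countable group has only countably many compact open subsets, so each
   isomorphism class accounts for countably many F with marked generators only; and
   there are uncountably many such F, built from the permutations of Z x N given by
   the shift of Z and by the exchange of (0, m) and (m + 1, m) for all m in a set T
   of N: the exchange commutes with its conjugate by the (m + 1)-st power of the
   shift if and only if m is not in T. *)
From HB Require Import structures.
Require Import Defs.
From mathcomp Require Import all_boot all_order all_algebra.
From mathcomp Require Import finmap zify.
From mathcomp Require Import all_classical all_reals all_analysis.
Set Implicit Arguments. Unset Strict Implicit. Unset Printing Implicit Defensive.
Local Open Scope classical_set_scope.

(** * The tree of reduced words *)

Section Tree.
Variable Omega : countType.

Definition reduced (s : seq Omega) := sorted (fun x y => x != y) s.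

Definition vertex := {s : seq Omega | reduced s}.

Implicit Types (x y o : Omega) (v w : vertex).

Definition toggle_seq x (s : seq Omega) :=
  if s is y :: s' then if x == y then s' else x :: s else [:: x].

Lemma reduced_toggle x s : reduced s -> reduced (toggle_seq x s).
Proof.
case: s => //= y s rs; case: eqP => [_|/eqP xy] /=; last by rewrite xy.
by case: s rs => //= z s /andP[].
Qed.

Definition nbr x v : vertex := Sub (toggle_seq x (val v)) (reduced_toggle x (valP v)).

Definition root : vertex := Sub [::] isT.

Definition len v := size (val v).

Lemma nbrK x : involutive (nbr x).
Proof.
move=> v; apply: val_inj; case: v => -[|y s] /= rs; first by rewrite eqxx.
case: (eqVneq x y) => [->|xy] /=; last by rewrite eqxx.
by case: s rs => //= z s /andP[/negPf->].
Qed.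

Lemma nbr_inj v : injective (nbr^~ v).
Proof.
move=> x y /(congr1 val); case: v => -[|z s] /= rs; first by case.
case: (eqVneq x z) (eqVneq y z) => [->|_] [->|_] // e.
- by move/(congr1 size): e => /= /eqP; rewrite -addn2 -[X in X == _]addn0 eqn_add2l.
- by move/(congr1 size): e => /= /eqP; rewrite -addn2 -[X in _ == X]addn0 eqn_add2l.
- by case: e.
Qed.

Lemma vertex_ind (P : vertex -> Prop) :
  P root -> (forall x v, P v -> P (nbr x v)) -> forall v, P v.
Proof.
move=> P0 Pn [s rs]; elim: s rs => [|x s IH] rs.
  by have <- : root = exist _ [::] rs by exact: val_inj.
have rs' : reduced s by case: s rs {IH} => //= y s /andP[].
have -> : exist _ (x :: s) rs = nbr x (exist _ s rs').
  apply: val_inj => /=; case: s rs {IH rs'} => //= y s /andP[/negPf xy _].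
  by rewrite xy.
exact/Pn/IH.
Qed.

Lemma vertex_ind_from (u : vertex) (P : vertex -> Prop) :
  P u -> (forall x v, P v -> P (nbr x v)) -> forall v, P v.
Proof.
move=> Pu Pn; apply: vertex_ind => //; elim/vertex_ind: u Pu => // x u IH.
by move=> /(Pn x); rewrite nbrK.
Qed.

Lemma odd_len x v : odd (len (nbr x v)) = ~~ odd (len v).
Proof.
case: v => -[|y s] //= rs; rewrite /len /=.
by case: eqP => //= _; rewrite negbK.
Qed.

Lemma nbr_neq x v : nbr x v <> v.
Proof. by move=> e; move: (odd_len x v); rewrite e; case: odd. Qed.

(* Words multiply in the free product of copies of Z/2 indexed by the colours;
   [act h u w] is [h(w) * u], so [rnbr o] is right multiplication by [o]. *)
Definition act (h : Omega -> Omega) u w : vertex :=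
  foldr (fun x => nbr (h x)) u (val w).

Lemma act_root h u : act h u root = u. Proof. by []. Qed.

Lemma act_nbr h u x w : act h u (nbr x w) = nbr (h x) (act h u w).
Proof.
case: w => -[|y s] //= rs; rewrite /act /=.
by case: eqP => [->|_] //=; rewrite nbrK.
Qed.

(** A map of the tree is determined by its image of the root and its local actions. The identities
    between translations below are checked in this way. *)
Lemma eq_vertex_map (g g' : vertex -> vertex) (h : vertex -> Omega -> Omega) :
  g root = g' root ->
  (forall x w, g (nbr x w) = nbr (h w x) (g w)) ->
  (forall x w, g' (nbr x w) = nbr (h w x) (g' w)) -> g =1 g'.
Proof. by move=> e gn gn'; elim/vertex_ind => // x v IH; rewrite gn gn' IH. Qed.

Lemma act_id w : act id root w = w.
Proof. by apply: (@eq_vertex_map _ id (fun=> id)) => // *; rewrite act_nbr. Qed.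

Lemma act_comp h h' w : act (h \o h') root w = act h root (act h' root w).
Proof.
by apply: (@eq_vertex_map _ (act h root \o act h' root) (fun=> h \o h')) => //= *;
  rewrite !act_nbr.
Qed.

Definition rnbr o := act id (nbr o root).

Lemma rnbr_root o : rnbr o root = nbr o root. Proof. by []. Qed.

Lemma rnbr_nbr o x w : rnbr o (nbr x w) = nbr x (rnbr o w).
Proof. exact: act_nbr. Qed.

Lemma rnbrK o : involutive (rnbr o).
Proof.
move=> w; apply: (@eq_vertex_map (rnbr o \o rnbr o) id (fun=> id)) => [|*|//].
  by rewrite /comp rnbr_root rnbr_nbr rnbr_root nbrK.
by rewrite /comp !rnbr_nbr.
Qed.

Lemma act_id_nbr y u w : act id (nbr y u) w = act id u (rnbr y w).
Proof.
apply: (@eq_vertex_map _ (act id u \o rnbr y) (fun=> id)) => [|*|*].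
- by rewrite /comp rnbr_root act_nbr.
- by rewrite act_nbr.
- by rewrite /comp rnbr_nbr act_nbr.
Qed.

Lemma odd_len_act h u w : odd (len (act h u w)) = odd (len w) (+) odd (len u).
Proof.
by elim/vertex_ind: w => //= x w IH; rewrite act_nbr !odd_len IH addNb.
Qed.

(** The half-tree beyond the edge from the root to [nbr o root]. Neighbours differ at the front of
    the word, so the last letter tells the branch at the root. Wrapping the letters in [Some] gives
    the empty word the value [None], which keeps the root out of every half-tree. *)
Definition half o w := last None (map Some (val w)) == Some o.

Definition crosses o v w :=
  (v == root) && (w == nbr o root) || (v == nbr o root) && (w == root).

Lemma half_root o : half o root = false. Proof. by []. Qed.

(** Toggling the first letter changes the last one only between the empty word and a word of one
    letter. *)
Lemma half_nbr o x w : half o (nbr x w) = half o w (+) crosses o w (nbr x w).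
Proof.
have e1 u : (u == nbr o root) = (val u == [:: o]) by rewrite -val_eqE.
have e0 u : (u == root) = (val u == [::]) by rewrite -val_eqE.
rewrite /half /crosses !e1 !e0; case: w => -[|y s] rs /=.
  by rewrite orbF eqseq_cons andbT (inj_eq Some_inj).
case: (eqVneq x y) => [xy|_] /=; last by rewrite andbF addbF.
subst y; case: s rs => [|z s] rs /=; last by rewrite eqseq_cons !andbF addbF.
by rewrite eqseq_cons !andbT (inj_eq Some_inj); case: (x == o).
Qed.

Lemma half_nbr_root o x : half o (nbr x root) = (x == o).
Proof. by []. Qed.

Lemma half_uniq o o' w : half o w -> half o' w -> o = o'.
Proof. by rewrite /half => /eqP-> /eqP[]. Qed.

Lemma half_boundary o x w : ~~ half o w -> half o (nbr x w) ->
  w = root /\ nbr x w = nbr o root.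
Proof.
move=> /negPf hw; rewrite half_nbr hw /= /crosses.
case/orP => /andP[/eqP e /eqP e'] //.
by move: hw; rewrite e half_nbr_root eqxx.
Qed.

(** Right multiplication by [o] inverts the edge between the root and [nbr o root], hence exchanges
    its two sides. *)
Lemma half_rnbr o w : half o (rnbr o w) = ~~ half o w.
Proof.
elim/vertex_ind: w => [|x w IH]; first by rewrite rnbr_root half_nbr_root eqxx.
rewrite rnbr_nbr !half_nbr IH -rnbr_nbr addNb; congr (~~ (_ (+) _)).
have e u v : (rnbr o u == v) = (u == rnbr o v) by rewrite (can2_eq (rnbrK o) (rnbrK o)).
rewrite /crosses !e -!(rnbr_root o) !rnbrK orbC.
by rewrite andbC [X in _ || X]andbC orbC; do 2 case: (_ == _); rewrite ?andbF ?andbT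
  ?orbF ?orbT.
Qed.

(** The half-trees at the root are disjoint, and [rnbr o] sends the complement of its half-tree into
    it. Iterated, this is the ping-pong behind the translations below. *)
Lemma half_rnbr_sub o o' w : o != o' -> half o' w -> half o (rnbr o w).
Proof.
by move=> oo' hw; rewrite half_rnbr; apply: contra oo' => /half_uniq /(_ hw) ->.
Qed.

Lemma val_rnbr o w : ~~ half o w -> val (rnbr o w) = rcons (val w) o.
Proof.
case: w => s rs /=; rewrite /half /rnbr /act /=.
elim: s rs => [|x s IH] //= rs hs.
have rs' : reduced s by case: s rs {IH hs} => //= y s /andP[].
rewrite IH //; last by case: s hs {IH rs rs'}.
case: s rs {IH rs'} hs => [|y s] /=.
  by move=> _; rewrite eqE /=; case: eqP.
by move=> /andP[/negPf->].
Qed.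

Lemma len_rnbr o w : ~~ half o w -> len (rnbr o w) = (len w).+1.
Proof. by move=> /val_rnbr e; rewrite /len e size_rcons. Qed.

End Tree.

Arguments root {Omega}.

(** * Inverses of bijections and words in involutions *)

Definition binv (T : choiceType) (g : T -> T) y := xget y [set x | g x = y].

Lemma binvKV (T : choiceType) (g : T -> T) : bijective g -> cancel (binv g) g.
Proof.
move=> [g' gK g'K] y; apply: (@xgetPex _ y [set x | g x = y]).
by exists (g' y); exact: g'K.
Qed.

Lemma binvK (T : choiceType) (g : T -> T) : bijective g -> cancel g (binv g).
Proof. by move=> bg x; apply: (bij_inj bg); rewrite binvKV. Qed.

Lemma binv_eq (T : choiceType) (g g' : T -> T) :
  cancel g g' -> cancel g' g -> binv g = g'.
Proof.
move=> gK g'K; apply/funext => x; apply: (can_inj gK).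
by rewrite g'K binvKV //; exists g'.
Qed.

Lemma bij_binv (T : choiceType) (g : T -> T) : bijective g -> bijective (binv g).
Proof. by move=> bg; exists g; [exact: binvKV|exact: binvK]. Qed.

Lemma binvV (T : choiceType) (g : T -> T) : bijective g -> binv (binv g) = g.
Proof. by move=> bg; apply: binv_eq; [exact: binvKV|exact: binvK]. Qed.

Definition word_map (J T : Type) (f : J -> T -> T) : seq J -> T -> T :=
  foldr (fun j h => f j \o h) id.

Lemma word_map_cat (J T : Type) (f : J -> T -> T) w w' :
  word_map f (w ++ w') = word_map f w \o word_map f w'.
Proof. by elim: w => //= j w ->. Qed.

Lemma word_map_revK (J T : Type) (f : J -> T -> T) w :
  (forall j, involutive (f j)) -> cancel (word_map f w) (word_map f (rev w)).
Proof.
move=> fK; elim: w => //= j w IH x.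
by rewrite rev_cons -cats1 word_map_cat /= fK IH.
Qed.

Lemma bij_word_map (J T : Type) (f : J -> T -> T) w :
  (forall j, involutive (f j)) -> bijective (word_map f w).
Proof.
move=> fK; exists (word_map f (rev w)); first exact: word_map_revK.
by have := @word_map_revK _ _ f (rev w) fK; rewrite revK.
Qed.

(** * Permutation groups with the topology of pointwise convergence *)

Definition perms (T : choiceType) (A : set (T -> T)) := {g : T -> T | A g}.

Section PermutationTopology.
Variables (T : choiceType) (A : set (T -> T)).
Local Notation perms := (perms A).

HB.instance Definition _ := gen_eqMixin perms.
HB.instance Definition _ := gen_choiceMixin perms.

Definition agree (l : seq T) (g : perms) : set perms :=
  [set g' | forall v, v \in l -> sval g' v = sval g v].

Let op : set_system perms := [set U | forall g, U g -> exists l, agree l g `<=` U].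

Let opT : op setT. Proof. by move=> g _; exists [::]. Qed.

Let opI : setI_closed op.
Proof.
move=> U V oU oV g [/oU[l lU] /oV[l' lV]]; exists (l ++ l') => g' e.
by split; [apply: lU|apply: lV] => v lv; apply: e; rewrite mem_cat lv ?orbT.
Qed.

Let op_bigU (I : Type) (U : I -> set perms) : (forall i, op (U i)) -> op (\bigcup_i U i).
Proof. by move=> oU g [i _ /oU[l lU]]; exists l => g' /lU ?; exists i. Qed.

HB.instance Definition _ := isOpenTopological.Build perms opT opI op_bigU.

Lemma perms_inj (g g' : perms) : sval g = sval g' -> g = g'.
Proof.
case: g g' => g Ag [g' Ag'] /= e; subst g'.
by congr exist; exact: Prop_irrelevance.
Qed.

Lemma open_permsP (U : set perms) : open U <-> forall g, U g -> exists l, agree l g `<=` U.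
Proof. by []. Qed.

Lemma open_agree l g : open (agree l g).
Proof.
by move=> g' e; exists l => g'' e' v lv; rewrite e' // e.
Qed.

Lemma nbhs_permsP (g : perms) (U : set perms) : nbhs g U <-> exists l, agree l g `<=` U.
Proof.
split=> [|[l lU]]; last first.
  rewrite nbhsE; exists (agree l g) => //; split => //; exact: open_agree.
rewrite nbhsE => -[V [/open_permsP oV /oV[l lV]] VU].
by exists l; exact: subset_trans VU.
Qed.

Lemma open_eval v (B : set T) : open [set g : perms | B (sval g v)].
Proof.
by move=> g Bg; exists [:: v] => g' /(_ v); rewrite inE eqxx /= => ->.
Qed.

Lemma closed_eval v (B : set T) : closed [set g : perms | B (sval g v)].
Proof. by rewrite -openC; exact: (@open_eval v (~` B)). Qed.

Lemma perms_zero_dimensional : zero_dimensional perms.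
Proof.
move=> g g' /eqP gg'.
have [v gv] : exists v, sval g v <> sval g' v.
  apply: contrapT => H; apply: gg'; apply: perms_inj; apply/funext => v.
  by apply: contrapT => ?; apply: H; exists v.
exists [set k | [set sval g v] (sval k v)]; split=> //; last exact/nesym.
by split; [exact: open_eval|exact: closed_eval].
Qed.

End PermutationTopology.

Record perm_group (T : choiceType) (A : set (T -> T)) : Prop := PermGroup {
  perm_group_bij : forall g, A g -> bijective g;
  perm_group_id : A id;
  perm_group_comp : forall g k, A g -> A k -> A (g \o k);
  perm_group_binv : forall g, A g -> A (binv g) }.

Section PermutationTopGroup.
Variables (T : choiceType) (A : set (T -> T)) (gA : perm_group A).
Local Notation perms := (perms A).

Definition perm_mul (g k : perms) : perms :=
  exist _ _ (perm_group_comp gA (svalP g) (svalP k)).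
Definition perm_inv (g : perms) : perms := exist _ _ (perm_group_binv gA (svalP g)).
Definition perm_one : perms := exist _ _ (perm_group_id gA).

Let bij_perm (g : perms) : bijective (sval g).
Proof. exact: (perm_group_bij gA (svalP g)). Qed.

Lemma perm_mulA g k m : perm_mul g (perm_mul k m) = perm_mul (perm_mul g k) m.
Proof. exact: perms_inj. Qed.

Lemma perm_mul1g g : perm_mul perm_one g = g.
Proof. exact: perms_inj. Qed.

Lemma perm_mulVg g : perm_mul (perm_inv g) g = perm_one.
Proof. by apply: perms_inj; apply/funext => v /=; rewrite binvK. Qed.

Lemma perm_mul_cont : continuous (fun p : perms * perms => perm_mul p.1 p.2).
Proof.
move=> [g k] U /nbhs_permsP[l lU].
exists (agree (map (sval k) l) g, agree l k).
  by split; apply: open_nbhs_nbhs; split => //; exact: open_agree.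
move=> [g' k'] /= [eg ek]; apply: lU => v lv /=.
by rewrite ek // eg // map_f.
Qed.

Lemma perm_inv_cont : continuous perm_inv.
Proof.
move=> g U /nbhs_permsP[l lU]; apply/nbhs_permsP.
exists (map (binv (sval g)) l) => g' e; apply: lU => v lv /=.
apply: (bij_inj (bij_perm g')); rewrite binvKV // e ?map_f //.
by rewrite binvKV.
Qed.

Definition perm_topGroup : topGroup :=
  TopGroup perm_mulA perm_mul1g perm_mulVg perm_mul_cont perm_inv_cont.

End PermutationTopGroup.

(** * Compact open sets as invariants *)

Section Codes.
Variables (T : countType) (A : set (T -> T)).

(** Each inner list is a finite table of prescribed values, and a code stands for the union of the
    basic open sets given by its tables. As [T] is countable, so is the set of codes. *)
Definition decode (c : seq (seq (T * T))) : set (perms A) :=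
  [set g | exists2 l, l \in c & all (fun p => sval g p.1 == p.2) l].

Lemma compact_open_code (U : set (perms A)) : compact U -> open U ->
  exists c, U = decode c.
Proof.
move=> cU /open_permsP oU.
have /choice[l lU] : forall g, exists l, U g -> agree l g `<=` U.
  move=> g; have [/oU[l lU]|nU] := pselect (U g); first by exists l.
  by exists [::].
have [[g0 _]|U0] := pselect (U !=set0); last first.
  exists [::]; apply/seteqP; split=> [g Ug|g []//]; by case: U0; exists g.
(* A point of [U] makes the space pointed, as the covering form of compactness requires; the empty
   set has the empty code. *)
pose P : ptopologicalType := HB.pack (perms A) (isPointed.Build (perms A) g0).
have : @compact P U by exact: cU.
rewrite compact_cover => /(_ (perms A) U (fun g => agree (l g) g)).
move=> /(_ (fun g _ => @open_agree _ _ (l g) g))[g Ug|X XU UX]; first by exists g.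
exists [seq [seq (v, sval g v) | v <- l g] | g : perms A <- X].
apply/seteqP; split=> [g /UX[g' g'X gg']|g [l' /mapP[g' g'X l'E] /allP gE]]; last subst l'.
- exists [seq (v, sval g' v) | v <- l g']; first exact: map_f.
  by apply/allP => p /mapP[v vl ->] /=; apply/eqP/gg'.
- have Ug' : U g' by have /set_mem := XU _ g'X.
  apply: (lU _ Ug') => v vl; apply/eqP.
  by have /gE : (v, sval g' v) \in [seq (v, sval g' v) | v <- l g'] by exact: map_f.
Qed.

End Codes.

Arguments decode {T} A c.

Section Relations.
Variables (J : Type) (G : topGroup).

Definition group_word (g : J -> G) : seq J -> G :=
  foldr (fun j => tg_mul (g j)) (tg_one G).

(** For [K] the pointwise stabiliser of a star and [D j] its coset inducing [f j], these are the
    relations between the [f j]. Only the group law and the given sets enter, so an isomorphism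
    carries the definition over. *)
Definition relation_from (K : set G) (D : J -> set G) : set (seq J) :=
  [set w | forall g, (forall j, D j (g j)) -> K (group_word g w)].

End Relations.

(** * The universal group of a permutation group *)

Section UniversalGroup.
Variables (Omega : countType) (J : finType) (f : J -> Omega -> Omega).
Hypothesis fK : forall j, involutive (f j).

Local Notation vertex := (vertex Omega).
Implicit Types (x y o : Omega) (v w u : vertex) (g k n : vertex -> vertex)
  (h : Omega -> Omega).

(** Positive words form a group because the generators are involutions: the reversed word gives the
    inverse. *)
Definition local_group : set (Omega -> Omega) := range (word_map f).

Lemma local_id : local_group id. Proof. by exists [::]. Qed.

Lemma local_comp h h' : local_group h -> local_group h' -> local_group (h \o h').
Proof. by move=> [w _ <-] [w' _ <-]; exists (w ++ w'); rewrite ?word_map_cat. Qed.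

Lemma local_bij h : local_group h -> bijective h.
Proof. by move=> [w _ <-]; exact: bij_word_map. Qed.

Lemma local_binv h : local_group h -> local_group (binv h).
Proof.
move=> [w _ <-]; exists (rev w) => //; apply/esym/binv_eq.
  exact: word_map_revK.
by have := @word_map_revK _ _ f (rev w) fK; rewrite revK.
Qed.

Definition tree_aut g := bijective g /\ forall w,
  exists2 h, local_group h & forall x, g (nbr x w) = nbr (h x) (g w).

Definition even_aut g := tree_aut g /\ forall w, odd (len (g w)) = odd (len w).

Lemma tree_aut_id : tree_aut id.
Proof. by split=> [|w]; [exists id|exists id => //; exact: local_id]. Qed.

Lemma tree_aut_comp g k : tree_aut g -> tree_aut k -> tree_aut (g \o k).
Proof.
move=> [bg gl] [bk kl]; split=> [|w]; first exact: bij_comp.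
have [h Fh hE] := kl w; have [h' Fh' h'E] := gl (k w).
by exists (h' \o h) => [|x]; [exact: local_comp|rewrite /= hE h'E].
Qed.

Lemma tree_aut_binv g : tree_aut g -> tree_aut (binv g).
Proof.
move=> [bg gl]; split=> [|w]; first exact: bij_binv.
have [h Fh hE] := gl (binv g w); exists (binv h) => [|x]; first exact: local_binv.
apply: (bij_inj bg); rewrite hE !binvKV //; exact: local_bij.
Qed.

Lemma even_aut_id : even_aut id.
Proof. by split=> //; exact: tree_aut_id. Qed.

Lemma even_aut_comp g k : even_aut g -> even_aut k -> even_aut (g \o k).
Proof.
by move=> [ag eg] [ak ek]; split=> [|w /=]; [exact: tree_aut_comp|rewrite eg ek].
Qed.

Lemma even_aut_binv g : even_aut g -> even_aut (binv g).
Proof.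
move=> [ag eg]; split=> [|w]; first exact: tree_aut_binv.
by rewrite -eg binvKV //; case: ag.
Qed.

Lemma even_aut_bij g : even_aut g -> bijective g. Proof. by case=> -[]. Qed.

Lemma tree_aut_rnbr o : tree_aut (rnbr o).
Proof.
split=> [|w]; first by exists (rnbr o); exact: rnbrK.
by exists id => [|x]; [exact: local_id|rewrite rnbr_nbr].
Qed.

Lemma even_aut_rnbr_conj o g : even_aut g -> even_aut (rnbr o \o g \o rnbr o).
Proof.
move=> [ag eg]; split=> [|w].
  apply: tree_aut_comp (tree_aut_rnbr o); exact: tree_aut_comp (tree_aut_rnbr o) ag.
by rewrite /= /rnbr !odd_len_act eg !odd_len_act -addbA addbb addbF.
Qed.

Lemma even_aut_rnbr2 o o' : even_aut (rnbr o \o rnbr o').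
Proof.
split=> [|w]; first by apply: tree_aut_comp; exact: tree_aut_rnbr.
by rewrite /= /rnbr !odd_len_act -addbA addbb addbF.
Qed.

Lemma tree_aut_act u : tree_aut (act id u).
Proof.
elim/vertex_ind: u => [|y u IH].
  by rewrite (_ : @act Omega id root = id :> (vertex -> vertex));
    [exact: tree_aut_id|apply/funext/act_id].
rewrite (_ : act id (nbr y u) = act id u \o rnbr y);
  last by apply/funext => w; exact: act_id_nbr.
exact: tree_aut_comp (tree_aut_rnbr y).
Qed.

Lemma even_aut_act u : odd (len u) = false -> even_aut (act id u).
Proof.
move=> eu; split=> [|w]; first exact: tree_aut_act.
by rewrite odd_len_act eu addbF.
Qed.

Lemma act_binvK h : bijective h -> cancel (act h root) (act (binv h) root).
Proof.
move=> bh w; rewrite -act_comp (_ : binv h \o h = id) ?act_id //.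
by apply/funext => x /=; rewrite binvK.
Qed.

Lemma act_binvKV h : bijective h -> cancel (act (binv h) root) (act h root).
Proof. by move=> bh w; rewrite -{1}(binvV bh) act_binvK //; exact: bij_binv. Qed.

Lemma even_aut_map h : local_group h -> even_aut (act h root).
Proof.
move=> Fh; have bh := local_bij Fh; split=> [|w]; last by rewrite odd_len_act addbF.
split=> [|w]; last by exists h => // x; rewrite act_nbr.
by exists (act (binv h) root); [exact: act_binvK|exact: act_binvKV].
Qed.

Lemma half_tree_aut g o o' w : tree_aut g ->
  (forall u v, crosses o' (g u) (g v) = crosses o u v) ->
  half o' (g w) = half o w (+) half o' (g root).
Proof.
move=> [_ gl] cr; elim/vertex_ind: w => // x w IH.
have [h _ hE] := gl w.
by rewrite half_nbr -(cr w) hE half_nbr IH addbAC.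
Qed.

Lemma half_fix g o w : tree_aut g -> g root = root -> g (nbr o root) = nbr o root ->
  half o (g w) = half o w.
Proof.
move=> ag g0 go; have [bg _] := ag.
have e (z y : vertex) : g z = z -> (g y == z) = (y == z).
  by move=> gz; rewrite -{1}gz inj_eq //; exact: bij_inj.
by rewrite (@half_tree_aut g o) ?g0 ?half_root ?addbF // => u v; rewrite /crosses !e.
Qed.

Lemma half_map h o w : local_group h -> half (h o) (act h root w) = half o w.
Proof.
move=> Fh; have [ah _] := even_aut_map Fh.
rewrite (@half_tree_aut _ o) ?half_root ?addbF // => u v.
case: ah => bg _; have e (z y : vertex) : (act h root y == act h root z) = (y == z).
  by rewrite inj_eq //; exact: bij_inj.
have e1 (y : vertex) : (act h root y == nbr (h o) root) = (y == nbr o root).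
  by rewrite -(e (nbr o root)) act_nbr.
by rewrite /crosses !e1 !(e root).
Qed.

(** * Gluing automorphisms on disjoint pieces of the tree *)

Section Glue.
Variables (I : Type) (Q : I -> set vertex).
Hypothesis Qdisj : forall i j w, Q i w -> Q j w -> i = j.

Definition glue (k : I -> vertex -> vertex) w :=
  if pselect (exists i, Q i w) is left e then k (projT1 (cid e)) w else w.

Lemma glueE (k : I -> vertex -> vertex) i w : Q i w -> glue k w = k i w.
Proof.
move=> Qw; rewrite /glue; case: pselect => [e|]; last by case; exists i.
by rewrite (Qdisj (projT2 (cid e)) Qw).
Qed.

Lemma glue_out (k : I -> vertex -> vertex) w : (forall i, ~ Q i w) -> glue k w = w.
Proof. by move=> nQ; rewrite /glue; case: pselect => // e; case: e (e) => i /nQ. Qed.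

Lemma glueK (k k' : I -> vertex -> vertex) : (forall i, cancel (k i) (k' i)) ->
  (forall i w, Q i w -> Q i (k i w)) -> cancel (glue k) (glue k').
Proof.
move=> kK kQ w; have [[i Qw]|nQ] := pselect (exists i, Q i w).
  by rewrite (glueE _ Qw) (glueE _ (kQ _ _ Qw)) kK.
have {}nQ i : ~ Q i w by move=> Qw; apply: nQ; exists i.
by rewrite glue_out glue_out.
Qed.

(** The glued map has the local action of [k i] on the piece [Q i] and the trivial one outside all
    pieces. An edge that leaves a piece has both ends fixed, so the prescriptions agree along it. *)
Lemma even_aut_glue (k : I -> vertex -> vertex) : (forall i, even_aut (k i)) ->
  (forall i w, Q i w -> Q i (k i w)) ->
  (forall i w, Q i w -> Q i (binv (k i) w)) ->
  (forall i x w, Q i w -> ~ Q i (nbr x w) ->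
     k i w = w /\ k i (nbr x w) = nbr x w) ->
  even_aut (glue k).
Proof.
move=> ak kQ kQV bdry; have bk i : bijective (k i) by case: (ak i) => -[].
split; last first.
  move=> w; have [[i Qw]|nQ] := pselect (exists i, Q i w).
    by rewrite (glueE _ Qw); case: (ak i).
  by rewrite glue_out // => i Qw; apply: nQ; exists i.
split.
  exists (glue (fun i => binv (k i))).
    by apply: glueK => // i; exact: binvK.
  by apply: glueK => // i; exact: binvKV.
have fixed x w j : Q j (nbr x w) -> ~ Q j w -> glue k (nbr x w) = nbr x w.
  move=> Qx nQ; rewrite (glueE _ Qx).
  by have := bdry j x _ Qx; rewrite nbrK => /(_ nQ)[].
move=> w; have [[i Qw]|nQ] := pselect (exists i, Q i w); last first.
  exists id => [|x]; first exact: local_id.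
  have {}nQ i : ~ Q i w by move=> Qw; apply: nQ; exists i.
  rewrite (glue_out _ nQ); have [[j Qx]|nQx] := pselect (exists j, Q j (nbr x w)).
    exact: fixed Qx (nQ j).
  by rewrite glue_out // => j Qx; apply: nQx; exists j.
have [[_ /(_ w)[h Fh hE]] _] := ak i; exists h => // x.
rewrite (glueE _ Qw) -hE.
have [Qx|nQx] := pselect (Q i (nbr x w)); first by rewrite (glueE _ Qx).
have [kw kx] := bdry _ _ _ Qw nQx; rewrite kx.
have [[j Qx]|nQ] := pselect (exists j, Q j (nbr x w)); last first.
  by rewrite glue_out // => j Qx; apply: nQ; exists j.
apply: (fixed _ _ _ Qx) => Qjw; apply: nQx.
by rewrite (Qdisj Qw Qjw).
Qed.

End Glue.


(** * Rigid stabilisers and Tits' commutator argument *)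

Record normal_in_even_aut (N : set (vertex -> vertex)) : Prop := NormalInEvenAut {
  normal_sub : forall g, N g -> even_aut g;
  normal_comp : forall g k, N g -> N k -> N (g \o k);
  normal_binv : forall g, N g -> N (binv g);
  normal_conj : forall g k, N g -> even_aut k -> N (k \o g \o binv k) }.

(** The rigid stabiliser of a half-tree: the pointwise stabiliser of the opposite half-tree. *)
Definition rigid o : set (vertex -> vertex) :=
  [set k | even_aut k /\ forall w, ~~ half o w -> k w = w].

Lemma rigid_half o k w : rigid o k -> half o (k w) = half o w.
Proof.
move=> [/even_aut_bij bk kid]; apply/idP/idP; last first.
  apply: contraLR => /[dup] /kid e nk; rewrite (_ : w = k w) //.
  exact/esym/(bij_inj bk).
by apply: contraLR => /[dup] nw /kid ->.
Qed.

(** [nbr o root] lies in the half-tree, but it is the only neighbour of the root there, so it is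
    fixed as well. *)
Lemma rigid_fix o k : rigid o k -> k root = root /\ k (nbr o root) = nbr o root.
Proof.
move=> rk; have [ak kid] := rk; have k0 : k root = root by exact: kid.
split=> //; have [[_ /(_ root)[h _ hE]] _] := ak.
have := rigid_half (nbr o root) rk; rewrite !hE k0 !half_nbr_root eqxx => /eqP->.
by [].
Qed.

(** Tits' independence property for an edge: [k] is [g] on the half-tree and the identity elsewhere,
    and [k'] is supported on the opposite side, which [rnbr o] carries to [half o]. *)
Lemma edge_stab_split o g : even_aut g -> g root = root -> g (nbr o root) = nbr o root ->
  exists k k', [/\ rigid o k, rigid o (rnbr o \o k' \o rnbr o) & g = k \o k'].
Proof.
move=> ag g0 go; have bg := even_aut_bij ag.
have hg w : half o (g w) = half o w by apply: half_fix => //; case: ag.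
have hV w : half o (binv g w) = half o w by rewrite -hg binvKV.
pose k := glue (fun _ : unit => [set w | half o w]) (fun=> g).
have disj : forall (i j : unit) (w : vertex), half o w -> half o w -> i = j.
  by do 2 case.
have ke w : half o w -> k w = g w.
  by move=> hw; exact: (glueE disj (fun=> g) (i := tt) hw).
have ko w : ~~ half o w -> k w = w by move=> /negP hw; exact: glue_out.
have rk : rigid o k.
  split=> //; apply: even_aut_glue => // [_ w|_ w|_ x w] /=.
  - by rewrite hg.
  - by rewrite hV.
  move=> hw /negP hx; have [] := @half_boundary _ o x (nbr x w) hx.
    by rewrite nbrK.
  by rewrite nbrK => -> ->.
have [ak _] := rk; have bk := even_aut_bij ak.
exists k, (binv k \o g); split=> //; last by apply/funext => w /=; rewrite binvKV.
split=> [|w hw].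
  by apply: even_aut_rnbr_conj; apply: even_aut_comp => //; exact: even_aut_binv.
have hw' : half o (rnbr o w) by rewrite half_rnbr.
by rewrite /= -ke // binvK // rnbrK.
Qed.

(* Tits' trick: if the translates of the half-tree under the powers of [t] are
   pairwise disjoint, the product [y] of the conjugates of [c] by these powers
   satisfies [c = [y, t]]. *)
Lemma rigid_in_normal N o t s k (D : set vertex) :
  normal_in_even_aut N -> N t -> even_aut s -> rigid o k ->
  (forall w, D w -> D (t w)) ->
  (forall w, half o (binv s w) -> D w) ->
  (forall w, half o (binv s (t w)) -> ~ D w) -> N k.
Proof.
move=> nN Nt as_ rk Dt PD Pt; have [ak kid] := rk.
have at_ := normal_sub nN Nt; have bt := even_aut_bij at_.
have bs := even_aut_bij as_; have bk := even_aut_bij ak.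
pose c := s \o k \o binv s.
have ac : even_aut c by do 2?[apply: even_aut_comp] => //; exact: even_aut_binv.
have bc := even_aut_bij ac.
pose P := [set w | half o (binv s w)].
have cP w : P (c w) <-> P w by rewrite /P /c /= binvK // rigid_half.
have cout w : ~ P w -> c w = w by move=> /negP nP; rewrite /c /= kid // binvKV.
have cVP w : P (binv c w) <-> P w by rewrite -cP binvKV.
have cbd x w : P w -> ~ P (nbr x w) -> c w = w /\ c (nbr x w) = nbr x w.
  move=> Pw nP; split; last exact: cout.
  have [[_ /(_ (nbr x w))[h _ hE]] _] := even_aut_binv as_.
  have := hE x; rewrite nbrK => e; rewrite /P /= e in Pw.
  have [_ e'] := half_boundary (introN idP nP) Pw.
  have [_ kr] := rigid_fix rk.
  by rewrite /c /= e e' kr -e' -e binvKV.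
pose tV := binv t; have tK : cancel t tV by exact: binvK.
have tVK : cancel tV t by exact: binvKV.
have iK i : cancel (iter i t) (iter i tV).
  by elim: i => // i IH w; rewrite iterSr iterS tK IH.
have iVK i : cancel (iter i tV) (iter i t).
  by elim: i => // i IH w; rewrite iterSr iterS tVK IH.
have ai i : even_aut (iter i t).
  by elim: i => [|i IH]; [exact: even_aut_id|exact: even_aut_comp at_ IH].
have iV i : binv (iter i t) = iter i tV by exact: binv_eq.
pose Q i := [set w | P (iter i tV w)].
have Dit i w : D w -> D (iter i t w) by move=> Dw; elim: i => //= i /Dt.
(* After a common power of [t] is removed, one translate is [P] itself and the other lies in the
   image of [D] under [t], which misses [P]. *)
have Qlt i d w : Q i w -> Q (i + d.+1) w -> False.
  rewrite /Q /= addnC iterD => Pi.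
  set w' := iter i tV w in Pi * => Pd; have := PD _ Pd.
  move=> /(Dit d) Dd; apply: (Pt (iter d t (iter d.+1 tV w'))) => //.
  by rewrite -iterS iVK.
have Qdisj i j w : Q i w -> Q j w -> i = j.
  move=> Qi Qj; case: (ltngtP i j) => // lt; exfalso.
    by apply: (@Qlt i (j - i.+1) w) => //; rewrite addnS -addSn subnKC.
  by apply: (@Qlt j (i - j.+1) w) => //; rewrite addnS -addSn subnKC.
pose ki i := iter i t \o c \o iter i tV.
have aki i : even_aut (ki i).
  by do 2?[apply: even_aut_comp] => //; rewrite -iV; exact: even_aut_binv.
have kiV i : binv (ki i) = iter i t \o binv c \o iter i tV.
  by apply: binv_eq => w; rewrite /ki /= !(iK, iVK) ?binvK ?binvKV // ?iVK.
pose y := glue Q ki.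
have ay : even_aut y.
  apply: even_aut_glue => // [i w|i w|i x w]; rewrite /Q /=.
  - by rewrite iK cP.
  - by rewrite kiV /= iK cVP.
  move=> Pw nP; have [[_ /(_ w)[h _ hE]] _] := even_aut_binv (ai i).
  move: hE; rewrite iV => hE; rewrite hE in nP.
  have [c1 c2] := cbd _ _ Pw nP.
  by rewrite /ki /= hE c1 c2 -hE !iVK.
have by_ := even_aut_bij ay.
(* Conjugation by [t] shifts the factors of [y] by one place, so that only the factor of index 0,
   namely [c], is missing. *)
have yE : y = c \o (t \o y \o tV).
  apply/funext => w /=.
  have [[i Qw]|nQ] := pselect (exists i, Q i w).
    rewrite /y (glueE Qdisj ki Qw); case: i Qw => [|i] Qw.
      rewrite glue_out ?tVK // => j; rewrite /Q /= -iterSr => Qj.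
      by have := Qdisj 0%N j.+1 w Qw Qj.
    have Qw' : Q i (tV w) by rewrite /Q /= -iterSr.
    have e : t (ki i (tV w)) = ki i.+1 w by rewrite /ki /= -iterSr.
    have Qk : Q i.+1 (ki i.+1 w).
      change (P (iter i.+1 tV (iter i.+1 t (c (iter i.+1 tV w))))).
      by rewrite iK; apply/cP.
    by rewrite (glueE Qdisj ki Qw') e cout // => P0; have := Qdisj 0%N _ _ P0 Qk.
  rewrite /y glue_out => [|i Qi]; last by apply: nQ; exists i.
  rewrite glue_out => [|i Qi]; last first.
    by apply: nQ; exists i.+1; rewrite /Q /= -iterS iterSr.
  by rewrite tVK cout // => P0; apply: nQ; exists 0%N.
have cE : c = y \o (t \o binv y \o tV).
  apply/funext => w /=; rewrite {1}yE /= tK.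
  by rewrite binvKV // tVK.
have Nc : N c.
  rewrite cE.
  have -> : y \o (t \o binv y \o tV) = (y \o t \o binv y) \o tV by [].
  by apply: (normal_comp nN); [exact: (normal_conj nN)|exact: (normal_binv nN)].
rewrite (_ : k = binv s \o c \o binv (binv s)).
  by apply: (normal_conj nN) => //; exact: even_aut_binv.
by apply/funext => w; rewrite binvV // /c /= !binvK.
Qed.


(** * Generation by edge stabilisers and simplicity *)

Hypothesis f_trans : forall x y, exists2 h, local_group h & h x = y.
Hypothesis f_fix : forall j, exists x, f j x = x.
Hypothesis f_nonfree : exists j x y, f j x = x /\ f j y <> y.

Lemma three_colours : exists x y z : Omega, [/\ x != y, x != z & y != z].
Proof.
have [j [x [y [fx /eqP fy]]]] := f_nonfree; exists x, y, (f j y).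
have xy : x != y by apply: contraNneq fy => <-; rewrite fx.
split=> //; last by rewrite eq_sym.
by apply: contra xy => /eqP e; rewrite -(fK j y) -e fx.
Qed.

Lemma colour_avoiding o o' : exists b : Omega, o != b /\ o' != b.
Proof.
have [x [y [z [xy xz yz]]]] := three_colours.
have [ox|ox] := eqVneq o x; have [oy|oy] := eqVneq o' y; subst.
- by exists z.
- by exists y.
- have [oz|oz] := eqVneq o z; last by exists z.
  by exists x; rewrite ox eq_sym.
- have [ox'|ox'] := eqVneq o' x; last by exists x.
  subst; have [oy'|oy'] := eqVneq o y; last by exists y.
  by subst; exists z.
Qed.

(** Each vertex lies in at most one half-tree at the root, so one of three colours avoids both. *)
Lemma half_avoiding u v : exists o : Omega, ~~ half o u /\ ~~ half o v.
Proof.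
have [x0 _] := three_colours.
have avoid w : exists c, forall o, c != o -> ~~ half o w.
  have [[c ho]|n] := pselect (exists o, half o w).
    by exists c => o; apply: contra => /(half_uniq ho)/eqP.
  by exists x0 => o _; apply/negP => ho; apply: n; exists o.
have [c hu] := avoid u; have [d hv] := avoid v.
have [b [/hu ? /hv ?]] := colour_avoiding c d.
by exists b.
Qed.

(* A path inside the half-tree can enter its image under [g] only through the
   vertex [g root], which lies outside the half-tree. *)
Lemma half_disjoint g o w : tree_aut g -> g root <> root ->
  ~~ half o (g root) -> ~~ half o (binv g root) -> half o w -> ~~ half o (g w).
Proof.
move=> ag g0 ho hV; have [bg _] := ag.
suff {w} H v : half o v -> ~~ half o (binv g v).
  by apply: contraL => /H; rewrite binvK.
elim/vertex_ind: v => [//|x v IH hx].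
apply/negP => hVx; have [_ /(_ v)[h Fh hE]] := tree_aut_binv ag.
have hVv : ~~ half o (binv g v).
  have [/IH //|nhv] := boolP (half o v).
  by have [-> _] := half_boundary nhv hx.
rewrite hE in hVx; have [e _] := half_boundary hVv hVx.
have ev : v = g root by rewrite -e binvKV.
have [hv|nhv] := boolP (half o v); first by rewrite ev (negPf ho) in hv.
by have [e' _] := half_boundary nhv hx; apply: g0; rewrite -ev.
Qed.

(** [rnbr o] changes parity, so it lies outside the group, but it normalises it. This carries
    statements about [half o] over to the opposite half-tree. *)
Lemma conj_rnbr_normal N o : normal_in_even_aut N ->
  normal_in_even_aut [set g | N (rnbr o \o g \o rnbr o)].
Proof.
have cc g : rnbr o \o (rnbr o \o g \o rnbr o) \o rnbr o = g.
  by apply/funext => w /=; rewrite !rnbrK.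
move=> nN; split=> [g /(normal_sub nN)|g k Ng Nk|g Ng|g k Ng ak] /=.
- by move/(even_aut_rnbr_conj o); rewrite cc.
- rewrite (_ : _ \o (g \o k) \o _ =
    (rnbr o \o g \o rnbr o) \o (rnbr o \o k \o rnbr o)).
    exact: (normal_comp nN Ng Nk).
  by apply/funext => w /=; rewrite rnbrK.
- have bg : bijective g.
    by have := even_aut_bij (even_aut_rnbr_conj o (normal_sub nN Ng)); rewrite cc.
  rewrite (_ : rnbr o \o _ \o _ = binv (rnbr o \o g \o rnbr o)).
    exact: (normal_binv nN).
  by apply/esym/binv_eq => w /=; rewrite rnbrK ?binvK ?binvKV ?rnbrK.
- have bk := even_aut_bij ak.
  rewrite (_ : rnbr o \o _ \o _ = (rnbr o \o k \o rnbr o) \o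
    (rnbr o \o g \o rnbr o) \o binv (rnbr o \o k \o rnbr o)).
    by apply: (normal_conj nN) => //; exact: even_aut_rnbr_conj.
  rewrite (@binv_eq _ (rnbr o \o k \o rnbr o) (rnbr o \o binv k \o rnbr o)).
  + by apply/funext => w /=; rewrite !rnbrK.
  + by move=> w /=; rewrite rnbrK binvK ?rnbrK.
  + by move=> w /=; rewrite rnbrK binvKV ?rnbrK.
Qed.

(** If only odd vertices moved, the image of one of them would still be adjacent to all its
    neighbours. Transported to the root, this image lies in every half-tree at the root, which two
    colours forbid. *)
Lemma moves_even g : even_aut g -> g <> id -> exists2 w, ~~ odd (len w) & g w <> w.
Proof.
move=> ag gid; have [w gw] : exists w, g w <> w.
  apply: contrapT => H; apply: gid; apply/funext => w.
  by apply: contrapT => gw; apply: H; exists w.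
have [ow|] := boolP (odd (len w)); last by exists w.
have [x [y [_ [xy _ _]]]] := three_colours.
apply: contrapT => H.
have ax u : tree_aut (@act Omega id u) by exact: tree_aut_act.
have [bs sl] := ax w; set s := act id w in bs sl.
have fixs z : g (s (nbr z root)) = s (nbr z root).
  apply: contrapT => gz; apply: H; exists (s (nbr z root)) => //.
  by rewrite /s act_nbr odd_len ow.
pose g' := binv s \o g \o s.
have ag' : tree_aut g'.
  by apply: tree_aut_comp (ax w); apply: tree_aut_comp (tree_aut_binv (ax w)) ag.1.
have g'0 : g' root <> root by move=> /(congr1 s); rewrite /g' /= binvKV.
have g'z z : g' (nbr z root) = nbr z root by rewrite /g' /= fixs binvK.
have hz z : half z (g' root).
  have [_ /(_ (nbr z root))[h _ /(_ z)]] := ag'; rewrite nbrK g'z => e.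
  rewrite e in g'0 *; rewrite half_nbr half_nbr_root eqxx addTb /crosses.
  by rewrite (negbTE (introN eqP g'0)) andbF; case: eqP => // /nbr_neq.
by move/eqP: xy; apply; exact: half_uniq (hz x) (hz y).
Qed.

(** From a non-trivial element of [N] two conjugates are formed whose product maps the complement of
    a half-tree strictly into itself; Tits' trick applies to this product. *)
Lemma normal_rigid N o : normal_in_even_aut N -> (exists2 g, N g & g <> id) ->
  rigid o `<=` N.
Proof.
move=> nN [g0 Ng0 g0id].
(* One colour is enough: [act h root], where [h] carries [c] to [o], conjugates one rigid stabiliser
   to the other. *)
suff {o} [c No] : exists o, rigid o `<=` N.
  move=> k [ak kid]; have [h Fh ho] := f_trans c o.
  have bh := local_bij Fh; have am := even_aut_map Fh; have bm := even_aut_bij am.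
  have aV := even_aut_binv am.
  rewrite (_ : k = act h root \o (binv (act h root) \o k \o act h root)
    \o binv (act h root)).
    apply: (normal_conj nN) => //; apply: No; split=> [|w hw].
      by apply: even_aut_comp am; exact: even_aut_comp.
    by rewrite /= kid ?binvK // -ho half_map.
  by apply/funext => w /=; rewrite !binvKV.
have [w ew gw] := moves_even (normal_sub nN Ng0) g0id.
have as_ : even_aut (@act Omega id w) by apply: even_aut_act; exact: negbTE.
set s := act id w in as_; have bs := even_aut_bij as_.
pose n1 := binv s \o g0 \o s.
have N1 : N n1.
  by rewrite /n1 -{2}(binvV bs); apply: (normal_conj nN) => //; exact: even_aut_binv.
have n10 : n1 root <> root by move=> /(congr1 s); rewrite /n1 /= binvKV.
have a1 := normal_sub nN N1; have b1 := even_aut_bij a1.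
have [ o [ho hV]] := half_avoiding (n1 root) (binv n1 root).
have disj v : half o v -> ~~ half o (n1 v) by apply: half_disjoint => //; case: a1.
exists o => k rk.
have [ o' [oo' _]] := colour_avoiding o o.
have [b [ob o'b]] := colour_avoiding o o'.
have [h Fh ho'] := f_trans o o'.
have [ o'' ho''] : exists o'', h o'' = o.
  by exists (binv h o); rewrite binvKV //; exact: local_bij.
have bh := local_bij Fh; have am := even_aut_map Fh.
(* [a] fixes [nbr o root], and its inverse sends the complement of [half o] into [half o]. Hence
   [n2], the conjugate of [n1] by [a], maps this complement into the image of [half o'] under
   [rnbr o], a part of [half o]. *)
pose a := rnbr o \o act h root \o rnbr o.
have aa : even_aut a by exact: even_aut_rnbr_conj.
have ba := even_aut_bij aa.
pose n2 := a \o n1 \o binv a.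
have N2 : N n2 by exact: (normal_conj nN).
have oo'' : o != o''.
  by apply: contra oo' => /eqP e; rewrite -ho' {2}e ho''.
have aV v : ~~ half o v -> half o (binv a v).
  move=> hv; rewrite (@binv_eq _ _ (rnbr o \o act (binv h) root \o rnbr o)).
  - apply: (half_rnbr_sub oo''); rewrite -(half_map _ _ Fh) act_binvKV // ho''.
    by rewrite half_rnbr.
  - by move=> u; rewrite /a /= rnbrK act_binvK // rnbrK.
  - by move=> u; rewrite /a /= rnbrK act_binvKV // rnbrK.
have n2D v : ~~ half o v -> half o' (rnbr o (n2 v)).
  move=> /aV/disj hv; rewrite /n2 /= /a /= rnbrK -ho' half_map // half_rnbr.
  by [].
have ar := even_aut_rnbr2 o b.
have at_ : even_aut (n1 \o (rnbr o \o rnbr b)) by exact: even_aut_comp.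
have tV : binv (n1 \o (rnbr o \o rnbr b)) = rnbr b \o rnbr o \o binv n1.
  by apply: binv_eq => v /=; rewrite ?binvK // !rnbrK ?binvKV // !rnbrK.
(* Here [s] carries [half o] into the image of [half b] under [n1 \o rnbr o], while [n1 \o n2]
   carries the complement of [half o] into the image of [half o'] under the same map. These are
   disjoint as [b] differs from [o']. *)
apply: (@rigid_in_normal N o (n1 \o n2) (n1 \o (rnbr o \o rnbr b)) k
  [set v | ~~ half o v]) => //; first exact: (normal_comp nN).
- by move=> v /n2D hv; apply: disj; rewrite -(rnbrK o (n2 v)); exact: half_rnbr_sub hv.
- move=> v; rewrite tV /= => hv; rewrite -(binvKV b1 v); apply: disj.
  rewrite -(rnbrK o (binv n1 v)); apply: (half_rnbr_sub ob).
  rewrite -(rnbrK b (rnbr o _)); apply: half_rnbr_sub hv.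
  by rewrite eq_sym.
- move=> v; rewrite tV /= binvK // => hv /n2D hv'.
  have hb : half b (rnbr b (rnbr o (n2 v))) by apply: half_rnbr_sub hv'; rewrite eq_sym.
  by move/eqP: ob; apply; exact: half_uniq hv hb.
Qed.

Lemma normal_edge_stab N o g : normal_in_even_aut N -> (exists2 g, N g & g <> id) ->
  even_aut g -> g root = root -> g (nbr o root) = nbr o root -> N g.
Proof.
move=> nN [g0 Ng0 g0id] ag gr go.
have [k [k' [rk rk' ->]]] := edge_stab_split ag gr go.
apply: (normal_comp nN); first by apply: normal_rigid rk => //; exists g0.
have nN' := conj_rnbr_normal o nN.
have cc n : rnbr o \o (rnbr o \o n \o rnbr o) \o rnbr o = n.
  by apply/funext => w /=; rewrite !rnbrK.
have := normal_rigid nN' _ rk'; rewrite /= cc; apply.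
exists (rnbr o \o g0 \o rnbr o); first by rewrite /= cc.
by move=> e; apply: g0id; rewrite -(cc g0) e; apply/funext => w /=; rewrite rnbrK.
Qed.

(** Rotations about the two ends of an edge move the root to every even vertex, two edges at a time.
    What remains is the stabiliser of the root, an edge stabiliser up to the local group. *)
Lemma generation (S : set (vertex -> vertex)) o :
  S id -> (forall g k, S g -> S k -> S (g \o k)) -> (forall g, S g -> S (binv g)) ->
  (forall g, even_aut g -> g root = root -> g (nbr o root) = nbr o root -> S g) ->
  (forall j, S (act (f j) root)) ->
  (forall j, S (rnbr o \o act (f j) root \o rnbr o)) ->
  even_aut `<=` S.
Proof.
move=> S1 SM SV Sedge Sf Srf.
have rr : rnbr o \o rnbr o = id by apply/funext => w /=; rewrite rnbrK.
have a1 : @act Omega id root = id by apply/funext => w; exact: act_id.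
have Smap h : local_group h -> S (act h root).
  move=> [w _ <-]; elim: w => [|j w IH] /=; first by rewrite a1.
  rewrite (_ : act _ _ = act (f j) root \o act (word_map f w) root); first exact: SM.
  by apply/funext => v /=; rewrite -act_comp.
have Srmap h : local_group h -> S (rnbr o \o act h root \o rnbr o).
  move=> [w _ <-]; elim: w => [|j w IH] /=.
    by rewrite a1 (_ : _ \o _ \o _ = rnbr o \o rnbr o) ?rr.
  rewrite (_ : _ \o _ \o _ = (rnbr o \o act (f j) root \o rnbr o) \o
    (rnbr o \o act (word_map f w) root \o rnbr o)); first exact: SM.
  by apply/funext => v /=; rewrite rnbrK -act_comp.
have Sroot g : even_aut g -> g root = root -> S g.
  move=> ag g0; have [[_ /(_ root)[h Fh hE]] _] := ag.
  have bh := local_bij Fh.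
  rewrite (_ : g = act h root \o (act (binv h) root \o g)).
    apply: SM; first exact: Smap.
    apply: Sedge => /=.
      by apply: even_aut_comp => //; apply/even_aut_map/local_binv.
      by rewrite g0.
    by rewrite hE g0 act_nbr binvK.
  by apply/funext => v /=; rewrite act_binvKV.
have trans v : ~~ odd (len v) -> exists2 g, S g & even_aut g /\ g root = v.
  (* Odd vertices are not in the orbit of the root; for them the induction carries some neighbour
     that is. *)
  suff : (~~ odd (len v) -> exists2 g, S g & even_aut g /\ g root = v) /\
    (odd (len v) -> exists x, exists2 g, S g & even_aut g /\ g root = nbr x v) by case.
  elim/vertex_ind: v => [|y v [IHe IHo]].
    by split=> // _; exists id => //; split=> //; exact: even_aut_id.
  rewrite odd_len negbK; split=> [/IHo|/IHe [g Sg ag]]; last first.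
    by exists y; rewrite nbrK; exists g.
  move=> [x [g Sg [ag gx]]].
  have [[_ /(_ root)[h Fh hE]] _] := ag; have bh := local_bij Fh.
  have [_ /(_ (nbr (binv h x) root))[h' Fh' hE']] := ag.1.
  have bh' := local_bij Fh'.
  set x1 := binv h x in hE'; set y1 := binv h' y.
  have -> : nbr y v = g (nbr y1 (nbr x1 root)).
    by rewrite hE' hE gx /x1 /y1 !binvKV // nbrK.
  have [p Fp px] := f_trans x1 o; have bp := local_bij Fp.
  have [q Fq qx] := f_trans o (p y1).
  have am := even_aut_map Fp; have amV := even_aut_map (local_binv Fp).
  have ar := even_aut_rnbr_conj o (even_aut_map Fq).
  exists (g \o (act (binv p) root \o (rnbr o \o act q root \o rnbr o))).
    by apply: (SM) => //; apply: (SM); [exact/Smap/local_binv|exact: Srmap].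
  split; first by do 2?[apply: even_aut_comp => //].
  congr (g _); rewrite /comp rnbr_root act_nbr act_root qx rnbr_nbr rnbr_root.
  by rewrite !act_nbr act_root -px !binvK.
move=> g ag; have [k Sk [ak k0]] : exists2 k, S k & even_aut k /\ k root = g root.
  by apply: trans; case: ag => _ ->.
have bk := even_aut_bij ak.
rewrite (_ : g = k \o (binv k \o g)); last by apply/funext => w /=; rewrite binvKV.
apply: SM => //; apply: Sroot => /=.
  by apply: even_aut_comp => //; exact: even_aut_binv.
by rewrite -k0 binvK.
Qed.

(** Each [f j] fixes a colour, so the rotations required by [generation] lie in edge stabilisers
    themselves, which [N] contains. *)
Lemma even_aut_simple N : normal_in_even_aut N -> (exists2 g, N g & g <> id) ->
  even_aut `<=` N.
Proof.
move=> nN ntN; have [g0 Ng0 g0id] := ntN; have [ o _] := three_colours.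
have nN' := conj_rnbr_normal o nN.
have cc n : rnbr o \o (rnbr o \o n \o rnbr o) \o rnbr o = n.
  by apply/funext => w /=; rewrite !rnbrK.
have ntN' : exists2 g, N (rnbr o \o g \o rnbr o) & g <> id.
  exists (rnbr o \o g0 \o rnbr o); first by rewrite cc.
  by move=> e; apply: g0id; rewrite -(cc g0) e; apply/funext => w /=; rewrite rnbrK.
have Ff j : local_group (f j) by exists [:: j].
have fe j x : f j x = x -> act (f j) root (nbr x root) = nbr x root.
  by move=> fx; rewrite act_nbr fx.
apply: (@generation N o).
- rewrite (_ : id = g0 \o binv g0).
    exact: (normal_comp nN Ng0 (normal_binv nN Ng0)).
  by apply/funext => w /=; rewrite binvKV //; exact: even_aut_bij (normal_sub nN Ng0).
- exact: normal_comp nN.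
- exact: normal_binv nN.
- by move=> g; exact: normal_edge_stab.
- move=> j; have [x fx] := f_fix j.
  by apply: (@normal_edge_stab _ x) => //; [exact: even_aut_map|exact: fe].
- move=> j; have [x fx] := f_fix j.
  by apply: (@normal_edge_stab _ x _ nN') => //; [exact: even_aut_map|exact: fe].
Qed.

Lemma even_aut_group : perm_group even_aut.
Proof.
split; [exact: even_aut_bij|exact: even_aut_id|exact: even_aut_comp|exact: even_aut_binv].
Qed.

Definition universal_group : topGroup := perm_topGroup even_aut_group.

Lemma universal_group_simple : abstractly_simple universal_group.
Proof.
split.
  have [j [x [y [fx fy]]]] := f_nonfree.
  have af : even_aut (act (f j) root) by apply: even_aut_map; exists [:: j].
  exists (exist _ _ af : universal_group) => /(congr1 sval) /= e.
  have := congr1 (fun g => g (nbr y root)) e; rewrite act_nbr => /nbr_inj.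
  exact: fy.
move=> N [[N1 NM NV] NJ].
pose N' := [set g : vertex -> vertex | exists2 n : universal_group, N n & sval n = g].
have nN' : normal_in_even_aut N'.
  split=> [g [n _ <-]|g k [n Nn <-] [m Nm <-]|g [n Nn <-]|g k [n Nn <-] ak].
  - exact: svalP.
  - by exists (tg_mul n m) => //; exact: NM.
  - by exists (tg_inv n) => //; exact: NV.
  - by exists (tg_mul (tg_mul (exist _ k ak : universal_group) n)
      (tg_inv (exist _ k ak : universal_group))) => //; exact: NJ.
have [[n Nn n1]|H] := pselect (exists2 n, N n & n <> tg_one universal_group); last first.
  left; apply/seteqP; split=> [n Nn|_ ->//].
  by apply: contrapT => n1; apply: H; exists n.
right; apply/seteqP; split=> // g _.
have [|m Nm e] := even_aut_simple nN' _ (svalP g).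
  exists (sval n); first by exists n.
  by move=> e; apply: n1; exact: perms_inj.
by rewrite -(perms_inj e).
Qed.

(** * Compactness, compact generation and non-discreteness *)

Hypothesis f_fin : forall x y, finite_set [set h | local_group h /\ h x = y].

(** Local actions at adjacent vertices agree on the colour of the joining edge, and finitely many
    elements of the local group have a given value there; so finiteness spreads along paths from
    [v0]. *)
Lemma finite_local_actions x0 y0 v0 a v :
  exists2 S : set (Omega -> Omega), finite_set S &
  forall g, even_aut g -> g v0 = a -> g (nbr x0 v0) = nbr y0 a ->
    exists2 h, S h /\ local_group h & forall x, g (nbr x v) = nbr (h x) (g v).
Proof.
elim/(@vertex_ind_from _ v0): v => [|x v [S fS HS]].
  exists [set h | local_group h /\ h x0 = y0] => // g [[_ /(_ v0)[h Fh hE]] _] g0 gx.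
  exists h => //; split=> //; split=> //.
  by have := hE x0; rewrite gx g0 => /nbr_inj.
exists (\bigcup_(h in S) [set h' | local_group h' /\ h' x = h x]).
  by apply: bigcup_finite => // h _; exact: f_fin.
move=> g ag g0 gx; have [h [Sh _] hE] := HS g ag g0 gx.
have [[_ /(_ (nbr x v))[h' Fh' h'E]] _] := ag; exists h' => //; split=> //.
exists h => //; split=> //.
by have := h'E x; rewrite nbrK hE => /(congr1 (nbr (h' x))); rewrite nbrK => /nbr_inj.
Qed.

Lemma ultra_finite_union (T : Type) (I : choiceType) (U : set_system T) (S : set I)
    (B : I -> set T) :
  UltraFilter U -> finite_set S -> U (\bigcup_(i in S) B i) -> exists2 i, S i & U (B i).
Proof.
move=> UU /finite_fsetP[X ->] UB; apply: contrapT => H.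
have UC i : i \in X -> U (~` B i).
  by move=> iX; have [Bi|] := in_ultra_setVsetC (B i) UU; first by case: H; exists i.
have [t [[i iX Bi] /(_ i iX)]] := filter_ex (filterI UB (filter_bigI _ UC)).
exact.
Qed.

Definition edge_coset x0 y0 v0 a : set (perms even_aut) :=
  [set g | sval g v0 = a /\ sval g (nbr x0 v0) = nbr y0 a].

Lemma edge_coset_open x0 y0 v0 a : open (edge_coset x0 y0 v0 a).
Proof.
have := openI (@open_eval _ even_aut v0 [set a])
  (@open_eval _ even_aut (nbr x0 v0) [set nbr y0 a]).
exact.
Qed.

Lemma edge_coset_closed x0 y0 v0 a : closed (edge_coset x0 y0 v0 a).
Proof.
have := closedI (@closed_eval _ even_aut v0 [set a])
  (@closed_eval _ even_aut (nbr x0 v0) [set nbr y0 a]).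
exact.
Qed.

(** Colours may be infinite in number, yet an ultrafilter selects one of finitely many local actions
    at each vertex, and these define the limit [p]. A pointwise limit of bijections need not be
    onto; here surjectivity comes from the bijective local actions. *)
Lemma edge_coset_compact x0 y0 v0 a : compact (edge_coset x0 y0 v0 a).
Proof.
rewrite compact_ultra => U UU UC /=.
have /choice[hv hvP] : forall v, exists h, local_group h /\
    U [set g | forall x, sval g (nbr x v) = nbr (h x) (sval g v)].
  move=> v; have [S fS HS] := finite_local_actions x0 y0 v0 a v.
  pose B h := [set g : perms even_aut | local_group h /\
    forall x, sval g (nbr x v) = nbr (h x) (sval g v)].
  have [|h _ Uh] := @ultra_finite_union _ _ U S B UU fS.
    apply: filterS UC => g [g0 gx].
    by have [h [Sh Fh] hE] := HS _ (svalP g) g0 gx; exists h.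
  exists h; split; last by apply: filterS Uh => g [].
  by have [g []] := filter_ex Uh.
have meet (A B : set (perms even_aut)) : U A -> U B -> exists2 g, A g & B g.
  by move=> UA UB; have [g []] := filter_ex (filterI UA UB); exists g.
have /choice[p pP] : forall v, exists u, U [set g | sval g v = u].
  elim/(@vertex_ind_from _ v0) => [|x v [u Uu]].
    by exists a; apply: filterS UC => g [].
  exists (nbr (hv v x) u); apply: filterS (filterI Uu (hvP v).2) => g [<- gE].
  by rewrite /= gE.
have p_uniq v u : U [set g | sval g v = u] -> p v = u.
  by move=> Uu; have [g <- <-] := meet _ _ Uu (pP v).
have p_nbr x v : p (nbr x v) = nbr (hv v x) (p v).
  have [g gE [g1 g2]] := meet _ _ (hvP v).2 (filterI (pP v) (pP (nbr x v))).
  by rewrite -g2 -g1 gE.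
have /choice[q qK] : forall u, exists v, p v = u.
  elim/(@vertex_ind_from _ a) => [|y u [v pv]].
    by exists v0; apply: p_uniq; apply: filterS UC => g [].
  have bh := local_bij (hvP v).1.
  by exists (nbr (binv (hv v) y) v); rewrite p_nbr binvKV // pv.
have p_inj : injective p.
  move=> v v' e; have [g g1 g2] := meet _ _ (pP v) (pP v').
  by apply: (bij_inj (even_aut_bij (svalP g))); rewrite g1 g2 e.
have ap : even_aut p.
  split; last first.
    move=> v; have [g <- _] := meet _ _ (pP v) (pP v).
    by case: (svalP g).
  split; first by exists q => // v; apply: p_inj; rewrite qK.
  by move=> v; exists (hv v) => [|x]; [exact: (hvP v).1|exact: p_nbr].
exists (exist _ p ap); split.
  by split=> /=; apply: p_uniq; apply: filterS UC => g [].
move=> V /nbhs_permsP[l lV]; apply: filterS lV _ => {V}.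
elim: l => [|v l IH]; first by apply: filterS (@filterT _ _ _) => g _ v.
apply: filterS (filterI (pP v) IH) => g [gv gl] w.
by rewrite inE => /predU1P[->|/gl].
Qed.

Lemma universal_group_locally_compact : locally_compact (setT : set universal_group).
Proof.
move=> g _; have [x0 _] := three_colours.
have [[_ /(_ root)[h _ hE]] _] := svalP g.
exists (edge_coset x0 (h x0) root (sval g root)); last first.
  by split; [exact: edge_coset_compact|exact: edge_coset_closed].
have gC : edge_coset x0 (h x0) root (sval g root) g by split=> //; exact: hE.
have : nbhs g (edge_coset x0 (h x0) root (sval g root)).
  by apply: open_nbhs_nbhs; split=> //; exact: edge_coset_open.
by apply: filterS.
Qed.

Lemma universal_group_totally_disconnected :
  totally_disconnected (setT : set universal_group).
Proof. exact: zero_dimension_totally_disconnected (@perms_zero_dimensional _ _). Qed.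

Lemma universal_group_compactly_generated : compactly_generated universal_group.
Proof.
have [c _] := three_colours.
have Ff j : local_group (f j) by exists [:: j].
pose m j : universal_group := exist _ _ (even_aut_map (Ff j)).
pose m' j : universal_group := exist _ _ (even_aut_rnbr_conj c (even_aut_map (Ff j))).
pose K : set universal_group := edge_coset c c root root `|` (range m `|` range m').
exists K; split.
  apply: compactU; first exact: edge_coset_compact.
  by apply: compactU; apply: finite_compact; apply: finite_image; exact: finite_finset.
apply/seteqP; split=> // g _ S [S1 SM SV] KS.
pose S' := [set k : vertex -> vertex | exists2 s : universal_group, S s & sval s = k].
have [||||||s Ss e] := @generation S' c _ _ _ _ _ _ (sval g) (svalP g).
- by exists (tg_one universal_group).
- by move=> _ _ [s Ss <-] [t St <-]; exists (tg_mul s t) => //; exact: SM.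
- by move=> _ [s Ss <-]; exists (tg_inv s) => //; exact: SV.
- move=> k ak k0 ko; exists (exist _ k ak : universal_group) => //.
  by apply: KS; left.
- by move=> j; exists (m j) => //; apply: KS; right; left; exists j.
- by move=> j; exists (m' j) => //; apply: KS; right; right; exists j.
by rewrite -(perms_inj e).
Qed.

(** Each application of [rnbr o \o rnbr o'] appends two letters to a word ending in [o], pushing the
    half-tree away from the root. *)
Lemma deep_half_tree o o' i : o != o' -> exists2 s, even_aut s &
  forall w, half o w -> half o (s w) /\ i < len (s w).
Proof.
move=> oo'; elim: i => [|i [s as_ sP]].
  exists id; first exact: even_aut_id.
  move=> w hw; split=> //; rewrite lt0n size_eq0; apply: contraTneq hw.
  by rewrite /half => ->.
exists ((rnbr o \o rnbr o') \o s); first exact: even_aut_comp (even_aut_rnbr2 o o') as_.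
move=> w /sP[hw lw] /=.
have hw' : half o' (rnbr o' (s w)) by apply: half_rnbr_sub hw; rewrite eq_sym.
split; first exact: half_rnbr_sub hw'.
have nh u c c' : c != c' -> half c u -> ~~ half c' u.
  by move=> cc' hc; apply: contra cc' => /(half_uniq hc)/eqP.
rewrite !len_rnbr ?ltnS; [exact: ltnW|exact: nh hw|by apply: nh hw'; rewrite eq_sym].
Qed.

(** A non-trivial element of a rigid stabiliser is conjugated until its half-tree avoids the
    finitely many vertices that define a neighbourhood of the identity. *)
Lemma universal_group_not_discrete : ~ discrete_topgroup universal_group.
Proof.
move=> /(_ [set tg_one universal_group]) /open_permsP /(_ _ erefl)[l lU].
have [j [x [y [fx fy]]]] := f_nonfree.
have Ff : local_group (f j) by exists [:: j].
have am := even_aut_map Ff.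
have xy : x != y by apply: contra_notN fy => /eqP <-; rewrite fx.
have [k [k' [rk rk' kE]]] : exists k k', [/\ rigid x k, rigid x (rnbr x \o k' \o rnbr x) &
    act (f j) root = k \o k'].
  by apply: edge_stab_split => //; rewrite act_nbr fx.
pose w := nbr y (nbr x root).
have hw : half x w.
  rewrite /w half_nbr half_nbr_root eqxx addTb /crosses.
  rewrite (negbTE (introN eqP (@nbr_neq _ x root))).
  rewrite eqxx /=; apply: contra xy => /eqP e; rewrite eq_sym.
  by apply/eqP; apply: (@nbr_inj _ (nbr x root)); rewrite e nbrK.
have kw : k w <> w.
  have := rk'.2 (rnbr x w); rewrite half_rnbr negbK hw /= rnbrK => /(_ erefl).
  move=> /(congr1 (rnbr x)); rewrite !rnbrK => k'w.
  have := congr1 (fun g => g w) kE; rewrite /= k'w => <-.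
  by rewrite /w act_nbr act_nbr fx => /nbr_inj.
have [s as_ sP] := deep_half_tree (\max_(v <- l) len v) xy.
have bs := even_aut_bij as_; have [ak kid] := rk.
have ae : even_aut (s \o k \o binv s).
  by apply: even_aut_comp (even_aut_binv as_); exact: even_aut_comp.
have /lU /(congr1 sval) /= e : agree l (tg_one universal_group) (exist _ _ ae).
  move=> v lv /=; rewrite kid ?binvKV //; apply/negP => /sP[_].
  by rewrite binvKV // ltnNge leq_bigmax_seq.
by apply: kw; have := congr1 (fun g => binv s (g (s w))) e; rewrite /= !binvK.
Qed.

Lemma universal_group_tdlc_cgs_nondiscrete : tdlc_cgs_nondiscrete universal_group.
Proof.
split.
- exact: universal_group_totally_disconnected.
- exact: universal_group_locally_compact.
- exact: universal_group_compactly_generated.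
- exact: universal_group_simple.
- exact: universal_group_not_discrete.
Qed.

(** [star id] is the pointwise stabiliser of the star of the root; every other non-empty [star h] is
    one of its cosets. *)
Definition star h : set (perms even_aut) :=
  [set g | sval g root = root /\ forall x, sval g (nbr x root) = nbr (h x) root].

Lemma star_compact h : compact (star h).
Proof.
have [c _] := three_colours.
apply: (subclosed_compact _ (@edge_coset_compact c (h c) root root)); last first.
  by move=> g [g0 gh]; split=> //; exact: gh.
rewrite (_ : star h = [set g | sval g root = root] `&`
    \bigcap_x [set g | sval g (nbr x root) = nbr (h x) root]).
  apply: closedI; first exact: (@closed_eval _ _ root [set root]).
  apply: closed_bigI => x _.
  exact: (@closed_eval _ _ (nbr x root) [set nbr (h x) root]).
apply/seteqP; split=> g [g0 gh]; split=> // x; last exact: gh.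
by move=> _; exact: gh.
Qed.

(** Although the star may be infinite, finitely many local actions send [c] to [h c], and one colour
    [d h'] for each [h'] among them tells it from [h]. *)
Lemma star_open h : open (star h).
Proof.
have [c _] := three_colours.
apply/open_permsP => g [g0 gh].
have /finite_fsetP[X XE] := f_fin c (h c).
have /choice[d dP] : forall h', exists x, h' <> h -> h' x <> h x.
  move=> h'; have [e|ne] := pselect (h' = h); first by exists c.
  apply: contrapT => H; apply: ne; apply/funext => x; apply: contrapT => hx.
  by apply: H; exists x.
exists (root :: nbr c root :: [seq nbr (d h') root | h' <- X]) => g' e.
have g'0 : sval g' root = root by rewrite e ?inE ?eqxx.
have [[_ /(_ root)[h' Fh' h'E]] _] := svalP g'; rewrite g'0 in h'E.
suff -> : h = h' by split.
have h'c : h' c = h c.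
  by apply: (@nbr_inj _ root); rewrite -h'E -gh e // !inE eqxx orbT.
have h'X : h' \in X.
  by have : [set h' | local_group h' /\ h' c = h c] h' by []; rewrite XE.
apply: contrapT => ne; apply: (dP h'); first exact: nesym.
apply: (@nbr_inj _ root); rewrite -h'E -gh e // !inE; apply/orP; right.
by apply/orP; right; exact: (map_f (fun h' => nbr (d h') root)).
Qed.

Lemma star_word (g : J -> universal_group) (w : seq J) : (forall j, star (f j) (g j)) ->
  star id (group_word g w) <-> word_map f w = id.
Proof.
move=> gs; have sw : star (word_map f w) (group_word g w).
  elim: w => [|j w [IH0 IH]] /=; first by [].
  by split=> [|x]; rewrite /= ?IH0 ?IH; case: (gs j).
split=> [[_ h1]|<- //]; apply/funext => x; apply: (@nbr_inj _ root).
by rewrite -(h1 x); case: sw.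
Qed.

(** An isomorphism maps [star id] and the [star (f j)] to compact open sets of the target, each
    given by a code. These finitely many codes determine all relations between the [f j]. *)
Lemma iso_relations_code (T : countType) (A : set (T -> T)) (gA : perm_group A) :
  topgroup_iso universal_group (perm_topGroup gA) ->
  exists (c0 : seq (seq (T * T))) (c : {ffun J -> seq (seq (T * T))}), forall w : seq J,
    relation_from (decode A c0 : set (perm_topGroup gA)) (fun j => decode A (c j)) w <->
    word_map f w = id.
Proof.
move=> [phi [psi [phiK psiK phiM phic psic]]].
have img_co (S : set universal_group) : compact S -> open S ->
    exists c : seq (seq (T * T)), phi @` S = decode A c.
  move=> cS oS; apply: compact_open_code.
    apply: (continuous_compact _ cS); exact: continuous_subspaceT.
  rewrite (_ : phi @` S = psi @^-1` S); first exact: (open_comp _ oS).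
  apply/seteqP; split=> [_ [g Sg <-]|g Sg] /=; first by rewrite phiK.
  by exists (psi g).
have [c0 c0E] := img_co _ (@star_compact id) (@star_open id).
have /choice[c cE] : forall j, exists c : seq (seq (T * T)), phi @` star (f j) = decode A c.
  by move=> j; apply: img_co; [exact: star_compact|exact: star_open].
exists c0, (finfun c) => w.
have phiw (g : J -> universal_group) :
    group_word (fun j => phi (g j)) w = phi (group_word g w).
  elim: (w) => [|j w' IH] /=; last by rewrite IH phiM.
  have e : tg_mul (phi (tg_one _)) (phi (tg_one _)) = phi (tg_one universal_group).
    by rewrite -phiM tg_mul1g.
  by rewrite -(tg_mul1g (phi (tg_one _))) -{1}(tg_mulVg (phi (tg_one universal_group)))
    -tg_mulA e tg_mulVg.
have Ff j : local_group (f j) by exists [:: j].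
have img (g : universal_group) (S : set universal_group) : (phi @` S) (phi g) <-> S g.
  by split=> [[g' Sg' /(can_inj phiK) <-]|Sg] //; exists g.
split=> [rel|fw g gD]; last first.
  pose g' j := psi (g j).
  have gE : g = fun j => phi (g' j) by apply/funext => j; rewrite psiK.
  rewrite gE phiw -c0E img star_word // => j.
  by apply/img; rewrite cE /g' psiK; have := gD j; rewrite ffunE.
pose m j : universal_group := exist _ _ (even_aut_map (Ff j)).
have ms j : star (f j) (m j) by split=> // x; exact: act_nbr.
rewrite -(star_word w ms) -img c0E -phiw; apply: rel => j.
by rewrite ffunE -cE; apply/img.
Qed.

End UniversalGroup.

(** * A continuum of local groups *)

Import GRing.Theory.

Section TwistedPermutations.
Variable T : nat -> bool.

Local Notation X := (int * nat)%type.
Local Notation Y := (X * option bool)%type.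

Definition shift (i : int) (p : X) : X := (p.1 + i, p.2)%R.

Definition exchange (p : X) : X :=
  if T p.2 then
    (if p.1 == 0%R then Posz p.2.+1 else if p.1 == Posz p.2.+1 then 0%R else p.1, p.2)
  else p.

Lemma shiftK i : cancel (shift i) (shift (- i)).
Proof. by case=> p k; rewrite /shift /= addrK. Qed.

Lemma shiftVK i : cancel (shift (- i)) (shift i).
Proof. by case=> p k; rewrite /shift /= addrNK. Qed.

Lemma exchangeK : involutive exchange.
Proof.
case=> p k; rewrite /exchange /=; case Tk : (T k) => /=; rewrite Tk //.
congr pair; case: (eqVneq p 0%R) => [->|p0] /=; first by rewrite eqxx.
by case: (eqVneq p (Posz k.+1)) => [->|pk]; rewrite ?eqxx // (negbTE p0) (negbTE pk).
Qed.

Definition swap (y : Y) : Y :=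
  match y.2 with
  | Some false => y
  | Some true => (y.1, None)
  | None => (y.1, Some true)
  end.

(* In the wreath product of Sym(X) with S_3, [twist q q^-1] is a conjugate of a
   transposition, whatever the permutation [q]. *)
Definition twist (q q' : X -> X) (y : Y) : Y :=
  match y.2 with
  | Some false => (q y.1, Some true)
  | Some true => (q' y.1, Some false)
  | None => y
  end.

Lemma swapK : involutive swap. Proof. by case=> p [[]|]. Qed.

Lemma twistK q q' : cancel q q' -> cancel q' q -> involutive (twist q q').
Proof. by move=> qK q'K [p [[]|]] //=; rewrite /twist /= ?qK ?q'K. Qed.

Local Notation J := (bool * bool)%type.
Local Notation j0 := (false, false).

(** Composed with [gen j0], the twists give the shift and the exchange on a copy of [X]; [swap]
    provides the even words that conjugate [gen j0] to every generator. *)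
Definition gen (j : J) : Y -> Y :=
  match j with
  | (false, false) => twist id id
  | (false, true) => swap
  | (true, false) => twist (shift 1) (shift (- 1))
  | (true, true) => twist exchange exchange
  end.

Arguments gen : simpl never.

Lemma genK j : involutive (gen j).
Proof.
case: j => [[] []]; [|..|exact: swapK|]; apply: twistK => //; try exact: exchangeK.
- exact: shiftK.
- exact: shiftVK.
Qed.

Definition even_word (x : Y -> Y) := exists2 w, ~~ odd (size w) & x = word_map gen w.

Definition colour := {x : Y -> Y | even_word x}.

Definition colour_word (x : colour) : seq J := s2val (cid2 (svalP x)).

Definition word_colour (w : seq J) : option colour :=
  if pselect (~~ odd (size w)) is left e then
    Some (exist _ (word_map gen w) (ex_intro2 _ _ w e erefl))
  else None.

Lemma colour_inj (x y : colour) : sval x = sval y -> x = y.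
Proof.
case: x y => x ex [y ey] /= e; subst y.
by congr exist; exact: Prop_irrelevance.
Qed.

Lemma colour_wordK : pcancel colour_word word_colour.
Proof.
move=> x; rewrite /colour_word; case: cid2 => w ew xE /=.
by rewrite /word_colour; case: pselect => // ?; congr Some; exact: colour_inj.
Qed.

HB.instance Definition _ := Countable.copy colour (pcan_type colour_wordK).

Lemma colour_bij (x : colour) : bijective (sval x).
Proof. by case: (svalP x) => w _ ->; apply: bij_word_map; exact: genK. Qed.

Lemma even_word_shift j x : even_word x -> even_word (gen j \o x \o gen j0).
Proof.
move=> [w ew ->]; exists (j :: rcons w j0); first by rewrite /= size_rcons /= negbK.
by rewrite -cats1 /= word_map_cat.
Qed.

(** With the parity of words recorded, this is left translation on the cosets of the subgroup of
    order two generated by the odd element [gen j0]; each coset is represented by its even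
    element. *)
Definition local_gen (j : J) (x : colour) : colour :=
  exist _ _ (even_word_shift j (svalP x)).

Lemma local_genK j : involutive (local_gen j).
Proof.
by move=> x; apply: colour_inj; apply/funext => y /=; rewrite !genK.
Qed.

Lemma iter_gen0 n y : iter n (gen j0) y = if odd n then gen j0 y else y.
Proof. by elim: n => //= n ->; case: odd => //=; rewrite genK. Qed.

Lemma word_map_local_gen w x : sval (word_map local_gen w x) =
  word_map gen w \o sval x \o iter (size w) (gen j0).
Proof.
elim: w => [|j w IH] //=; rewrite IH; apply/funext => y.
by rewrite /comp iterSr.
Qed.

Lemma word_map_local_gen_even w x : ~~ odd (size w) ->
  sval (word_map local_gen w x) = word_map gen w \o sval x.
Proof.
move=> ew; rewrite word_map_local_gen; apply/funext => y; rewrite /comp iter_gen0.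
by rewrite (negbTE ew).
Qed.

Local Notation F := (local_group local_gen).

Lemma local_gen_trans x y : exists2 h, F h & h x = y.
Proof.
have [w ew xE] := svalP x; have [w' ew' yE] := svalP y.
exists (word_map local_gen (w' ++ rev w)); first by exists (w' ++ rev w).
apply: colour_inj; rewrite word_map_local_gen_even.
  by rewrite word_map_cat xE yE; apply/funext => p /=;
      rewrite word_map_revK //; exact: genK.
by rewrite size_cat size_rev oddD (negbTE ew) (negbTE ew').
Qed.

(** A fixed colour is an even word conjugating [gen j0] to [gen j]. For a twist,
    [twist q q' \o gen j0] acts by [q] and [q'] on two copies of [X]; conjugation by [swap] moves
    the first action to the third copy, which gives such a word. *)
Lemma local_gen_fix j : exists x, local_gen j x = x.
Proof.
have ev w : ~~ odd (size w) -> even_word (word_map gen w) by exists w.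
have [w ew wE] : exists2 w, ~~ odd (size w) &
    gen j \o word_map gen w = word_map gen w \o gen j0.
  have tw q q' : cancel q q' -> cancel q' q ->
      twist q q' \o (swap \o twist q q' \o gen j0 \o swap) =
      (swap \o twist q q' \o gen j0 \o swap) \o gen j0.
    move=> qK q'K; apply/funext => -[p [[]|]];
      by rewrite /= /gen /swap /twist /= ?qK ?q'K.
  case: j => [[] []].
  - by exists [:: (false, true); (true, true); j0; (false, true)] => //;
      exact: tw exchangeK exchangeK.
  - exists [:: (false, true); (true, false); j0; (false, true)] => //; apply: tw.
      exact: shiftK.
    exact: shiftVK.
  - by exists [:: j0; (false, true)] => //; apply/funext => -[p [[]|]].
  - by exists [::].
exists (exist _ _ (ev w ew)); apply: colour_inj => /=.
by rewrite wE; apply/funext => y /=; rewrite -/(gen j0) genK.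
Qed.

Lemma local_gen_nonfree : exists j x y, local_gen j x = x /\ local_gen j y <> y.
Proof.
have e0 : even_word id by exists [::].
have e1 : even_word (swap \o gen j0) by exists [:: (false, true); j0].
exists j0, (exist _ _ e0), (exist _ _ e1); split.
  by apply: colour_inj; apply/funext => -[p [[]|]].
by move=> /(congr1 sval) /(congr1 (fun g => (g ((0%R, 0), Some true)).2)).
Qed.

(** For a given parity, the image of one colour determines the permutation spelt by the word, so
    there are at most two such [h]. *)
Lemma local_gen_fin x y : finite_set [set h | F h /\ h x = y].
Proof.
have sub1 (S : set (colour -> colour)) :
    (forall h h', S h -> S h' -> h = h') -> finite_set S.
  move=> S1; have [[h Sh]|nS] := pselect (S !=set0).
    by apply: (@sub_finite_set _ _ [set h]) => // h' Sh'; exact: S1.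
  by rewrite (_ : S = set0) //; apply/seteqP; split=> // h Sh; apply: nS; exists h.
pose S b := [set h | exists w, [/\ odd (size w) = b, h = word_map local_gen w & h x = y]].
apply: (@sub_finite_set _ _ (S false `|` S true)).
  by move=> _ [[w _ <-] wx]; case E : (odd (size w)); [right|left]; exists w.
suff SF b : finite_set (S b) by rewrite finite_setU.
apply: sub1 => _ _ [w [ow -> wx]] [w' [ow' -> w'x]].
have pE n : iter n (gen j0) = if odd n then gen j0 else id.
  by apply/funext => p; rewrite iter_gen0; case: odd.
have bi n : bijective (iter n (gen j0)).
  by rewrite pE; case: odd; [exists (gen j0); exact: genK|exists id].
have e : word_map gen w = word_map gen w'.
  have := congr1 sval (etrans wx (esym w'x)).
  rewrite !word_map_local_gen !pE ow ow' -{1}ow -ow -!pE => e.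
  apply/funext => p.
  have := congr1 (fun g => g (binv (iter (size w) (gen j0)) (binv (sval x) p))) e.
  by rewrite /= !binvKV //; exact: colour_bij.
apply/funext => z; apply: colour_inj; rewrite !word_map_local_gen e.
by rewrite !pE ow ow'.
Qed.

(** [a] spells the exchange and [b] its conjugate by the shift by [m + 1]. Both act as involutions,
    so the word [a b a b] is their commutator. *)
Definition test_word (m : nat) : seq J :=
  let a := [:: (true, true); j0] in
  let b := flatten (nseq m.+1 [:: (true, false); j0]) ++ a ++
    flatten (nseq m.+1 [:: j0; (true, false)]) in
  a ++ b ++ a ++ b.

Lemma odd_size_test_word m : ~~ odd (size (test_word m)).
Proof.
have e (s : seq J) n : odd (size (flatten (nseq n s))) = odd n && odd (size s).
  by elim: n => //= n IH; rewrite size_cat oddD IH; case: odd; case: odd.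
by rewrite !size_cat !oddD !e !andbF.
Qed.

Definition lift (q q' : X -> X) (y : Y) : Y :=
  match y.2 with
  | Some true => (q y.1, Some true)
  | Some false => (q' y.1, Some false)
  | None => y
  end.

Lemma lift_comp q q' r r' : lift q q' \o lift r r' = lift (q \o r) (q' \o r').
Proof. by apply/funext => -[p [[]|]]. Qed.

Lemma lift_id : lift id id = id.
Proof. by apply/funext => -[p [[]|]]. Qed.

Lemma lift_inj_id q q' : lift q q' = id -> q = id.
Proof.
by move=> e; apply/funext => p; have [] := congr1 (fun g => g (p, Some true)) e.
Qed.

Lemma word_map_shift (n : nat) :
  word_map gen (flatten (nseq n [:: (true, false); j0])) =
    lift (shift n) (shift (- n%:Z)) /\
  word_map gen (flatten (nseq n [:: j0; (true, false)])) =
    lift (shift (- n%:Z)) (shift n).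
Proof.
have s0 : shift 0 = id by apply/funext => -[p k]; rewrite /shift addr0.
have sD i i' : shift i \o shift i' = shift (i + i').
  by apply/funext => -[p k]; rewrite /shift /= addrAC addrA.
elim: n => [|n [IH IH']]; first by rewrite /= oppr0 s0 lift_id.
rewrite /nseq -/(nseq n _) [flatten _]/= -!/(cat _ _) -[_ :: _ :: _]/([:: _; _] ++ _).
have e1 : word_map gen [:: (true, false); j0] = lift (shift 1) (shift (- 1)).
  by apply/funext => -[p [[]|]].
have e2 : word_map gen [:: j0; (true, false)] = lift (shift (- 1)) (shift 1).
  by apply/funext => -[p [[]|]].
split; rewrite word_map_cat ?e1 ?e2 ?IH ?IH' lift_comp !sD.
  by rewrite -opprD -[n.+1]add1n PoszD.
by rewrite -opprD -[n.+1]add1n PoszD.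
Qed.

Definition test_perm (d : int) : X -> X :=
  let e := exchange \o (shift d \o exchange \o shift (- d)) in e \o e.

Lemma word_map_test_word m : word_map gen (test_word m) =
  lift (test_perm (Posz m.+1)) (test_perm (- Posz m.+1)).
Proof.
have [e1 e2] := word_map_shift m.+1.
have ea : word_map gen [:: (true, true); j0] = lift exchange exchange.
  by apply/funext => -[p [[]|]].
rewrite /test_word; move: (flatten _) (flatten _) e1 e2 => B B' e1 e2.
rewrite !word_map_cat ea e1 e2 !lift_comp /test_perm opprK.
by congr lift.
Qed.

Let sw (K i : int) : int := if i == 0%R then K else if i == K then 0%R else i.

Let swP (K i : int) :
  [\/ i = 0%R /\ sw K i = K, i = K /\ sw K i = 0%R | [/\ i <> 0%R, i <> K & sw K i = i]].
Proof.
rewrite /sw; case: (eqVneq i 0%R) => [->|/eqP i0]; first by apply: Or31.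
by case: (eqVneq i K) => [->|/eqP iK]; [apply: Or32|apply: Or33].
Qed.

Lemma exchangeE p : exchange p = if T p.2 then (sw (Posz p.2.+1) p.1, p.2) else p.
Proof. by []. Qed.

(** On a level [k] with [T k], the transpositions of 0 with [k + 1] and of [d] with [k + 1 + d]
    share a point only if [k + 1] is [d] or [-d], that is, if [k = m]. On all other levels they are
    disjoint and commute. *)
Lemma test_perm_id d m : ~~ T m -> d = Posz m.+1 \/ d = (- Posz m.+1)%R ->
  test_perm d = id.
Proof.
move=> Tm dm; apply/funext => -[i k]; rewrite /test_perm /comp /shift !exchangeE.
case Tk : (T k); rewrite /= !Tk /=; last by rewrite ?Tk /= ?subrK ?Tk /= ?subrK.
have km : k <> m by move=> e; rewrite -e Tk in Tm.
congr pair; set K := Posz k.+1.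
have K0 : K <> d /\ K <> (- d)%R /\ d <> 0%R by rewrite /K; lia.
move: (swP K (i - d)); move: (sw K (i - d)) => i1 H1.
move: (swP K (i1 + d)); move: (sw K (i1 + d)) => i2 H2.
move: (swP K (i2 - d)); move: (sw K (i2 - d)) => i3 H3.
move: (swP K (i3 + d)); move: (sw K (i3 + d)) => i4 H4.
move: K i1 i2 i3 i4 K0 H1 H2 H3 H4 => K i1 i2 i3 i4 [? [? ?]] H1 H2 H3 H4.
case: H1 => [[? e1]|[? e1]|[? ? e1]]; case: H2 => [[? e2]|[? e2]|[? ? e2]]; try lia;
  case: H3 => [[? e3]|[? e3]|[? ? e3]]; try lia; case: H4 => [[? e4]|[? e4]|[? ? e4]]; lia.
Qed.

(** On level [m] the two transpositions share the point [m + 1]; their product is a 3-cycle, whose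
    square moves 0. *)
Lemma test_perm_neq m : T m -> test_perm (Posz m.+1) <> id.
Proof.
move=> Tm /(congr1 (fun g => (g (0%R, m)).1)).
rewrite /test_perm /comp /shift !exchangeE /= !Tm /= ?Tm /= ?Tm /=.
have K0 : Posz m.+1 <> 0%R by [].
move: (Posz m.+1) K0 => K K0.
move: (swP K (0 - K)); move: (sw K (0 - K)) => i1 H1.
move: (swP K (i1 + K)); move: (sw K (i1 + K)) => i2 H2.
move: (swP K (i2 - K)); move: (sw K (i2 - K)) => i3 H3.
move: (swP K (i3 + K)); move: (sw K (i3 + K)) => i4 H4.
case: H1 => [[? e1]|[? e1]|[? ? e1]]; case: H2 => [[? e2]|[? e2]|[? ? e2]]; try lia;
  case: H3 => [[? e3]|[? e3]|[? ? e3]]; try lia; case: H4 => [[? e4]|[? e4]|[? ? e4]]; lia.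
Qed.

Lemma test_wordP m : word_map local_gen (test_word m) = id <-> ~~ T m.
Proof.
have eE := odd_size_test_word m.
have -> : (word_map local_gen (test_word m) = id) <-> (word_map gen (test_word m) = id).
  split=> [e|e]; last first.
    by apply/funext => x; apply: colour_inj; rewrite word_map_local_gen_even // e.
  have e0 : even_word id by exists [::].
  by have := word_map_local_gen_even (exist _ _ e0) eE; rewrite e.
rewrite word_map_test_word; split=> [/lift_inj_id|Tm].
  by move=> c1; apply/negP => /test_perm_neq.
by rewrite !(test_perm_id Tm) ?lift_id //; [right|left].
Qed.

End TwistedPermutations.

(** * Uncountably many isomorphism classes *)

Definition continuum_group (T : nat -> bool) : topGroup := universal_group (@local_genK T).

Lemma continuum_group_tdlc T : tdlc_cgs_nondiscrete (continuum_group T).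
Proof.
apply: universal_group_tdlc_cgs_nondiscrete.
- exact: local_gen_trans.
- exact: local_gen_fix.
- exact: local_gen_nonfree.
- exact: local_gen_fin.
Qed.

Lemma topgroup_iso_refl G : topgroup_iso G G.
Proof. by exists id, id; split=> // x; exact: cvg_id. Qed.

Lemma topgroup_iso_sym G H : topgroup_iso G H -> topgroup_iso H G.
Proof.
move=> [f [g [fK gK fM fc gc]]]; exists g, f; split=> // x y.
by apply: (can_inj fK); rewrite fM !gK.
Qed.

Lemma topgroup_iso_trans G H K : topgroup_iso G H -> topgroup_iso H K -> topgroup_iso G K.
Proof.
move=> [f [g [fK gK fM fc gc]]] [f' [g' [f'K g'K f'M f'c g'c]]].
exists (f' \o f), (g \o g'); split.
- by move=> x /=; rewrite f'K fK.
- by move=> x /=; rewrite gK g'K.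
- by move=> x y /=; rewrite fM f'M.
- by move=> x; apply: continuous_comp; [exact: fc|exact: f'c].
- by move=> x; apply: continuous_comp; [exact: g'c|exact: gc].
Qed.

(** Cantor's diagonal argument: [D] consists of the [n] that belong to no [T] with [g T = n]. *)
Lemma continuum_not_injected (g : (nat -> bool) -> nat) : ~ injective g.
Proof.
move=> g_inj; pose D n := ~~ `[< exists T, g T = n /\ T n >].
have [DD|/negP nD] := boolP (D (g D)).
  by move: (DD); rewrite {1}/D => /asboolPn; apply; exists D.
apply: nD; apply/asboolPn => -[T [/g_inj-> DD]]; move: (DD).
by rewrite {1}/D => /asboolPn; apply; exists D.
Qed.

(* There are only countably many codes [p], although the type of codes depends
   on [T']. *)
Lemma iso_invariant T' : exists Q : (nat -> bool) -> nat -> Prop,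
  (forall T, topgroup_iso (continuum_group T) (continuum_group T') -> exists p, Q T p) /\
  (forall T U p, Q T p -> Q U p -> T = U).
Proof.
pose V : countType := vertex (colour T').
pose A : set (V -> V) := even_aut (@local_gen T').
pose J := (bool * bool)%type.
pose C : countType := (seq (seq (V * V)) * {ffun J -> seq (seq (V * V))})%type.
pose rel (c : C) := relation_from (decode A c.1 : set (continuum_group T'))
  (fun j => decode A (c.2 j)).
exists (fun T p => exists c : C, choice.pickle c = p /\
  forall w, rel c w <-> word_map (@local_gen T) w = id); split=> [T iso|T U p].
  have [c0 [c cE]] := iso_relations_code (@local_gen_nonfree T)
    (@local_gen_fin T) iso.
  by exists (choice.pickle ((c0, c) : C)), (c0, c).
move=> [c [<- cT]] [d [/(pcan_inj choice.pickleK) -> dU]]; apply/funext => m.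
apply: negb_inj; apply/idP/idP => /test_wordP.
  by move/cT/dU/test_wordP.
by move/dU/cT/test_wordP.
Qed.

Theorem theorem7p4 :
  exists (I : Type) (G : I -> topGroup),
    [/\ uncountable_type I,
        (forall i, tdlc_cgs_nondiscrete (G i)) &
        (forall i j, i <> j -> ~ topgroup_iso (G i) (G j))].
Proof.
(* The indices are the isomorphism classes of the groups [continuum_group T], each with a chosen
   representative. *)
pose cls T := [set U | topgroup_iso (continuum_group T) (continuum_group U)].
pose I := {c : set (nat -> bool) | exists T, c = cls T}.
pose rep (i : I) := projT1 (cid (svalP i)).
have repE i : sval i = cls (rep i) by exact: projT2 (cid (svalP i)).
exists I, (fun i => continuum_group (rep i)); split.
- move=> [e e_inj].
  pose inc T : I := exist _ (cls T) (ex_intro _ T erefl).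
  have isoT T : topgroup_iso (continuum_group T) (continuum_group (rep (inc T))).
    have : cls T (rep (inc T)) by
      rewrite -[cls T]/(sval (inc T)) repE; exact: topgroup_iso_refl.
    by [].
  have /choice[Q QP] := fun i => iso_invariant (rep i).
  have /choice[p pP] : forall T, exists p, Q (inc T) T p.
    by move=> T; apply: (QP _).1; exact: isoT.
  (* If the classes were countable, the class of [T] together with the code of [T] relative to the
     representative would determine [T] and embed the continuum into [nat]. *)
  apply: (@continuum_not_injected (fun T => choice.pickle (e (inc T), p T))) => T U.
  move=> /(pcan_inj choice.pickleK)[/e_inj iTU pTU]; apply: (QP (inc T)).2 (pP T) _.
  by rewrite iTU pTU; exact: pP.
- by move=> i; exact: continuum_group_tdlc.
- move=> i j ij iso; apply: ij.
  have e : sval i = sval j.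
    rewrite !repE; apply/seteqP; split=> T iT.
      exact: topgroup_iso_trans (topgroup_iso_sym iso) iT.
    exact: topgroup_iso_trans iso iT.
  case: i j {iso} e => c ci [d dj] /= e; subst d.
  by congr exist; exact: Prop_irrelevance.
Qed.
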